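(* Let $3\le n+1\le m<2n$. Let $F:\mathbb{B}^n\to D^{IV}_m$ be a holomorphic isometry which is a rational map with $F(0)=0$. Then $\deg(F)=2$.
   Context: $\mathbb{B}^n=\{z\in\mathbb{C}^n:|z|^2<1\}$; $D^{IV}_m=\{Z\in\mathbb{C}^m: Z\overline{Z}^t<2,\ 1-Z\overline{Z}^t+\tfrac14|ZZ^t|^2>0\}$. Bergman metric $\omega_\Omega=\sqrt{-1}\partial\bar\partial\log K_\Omega$ with $K_{\mathbb{B}^n}=c(1-|z|^2)^{-(n+1)}$, $K_{D^{IV}_m}=c'(1-Z\overline{Z}^t+\tfrac14|ZZ^t|^2)^{-m}$; a holomorphic $F$ is a holomorphic isometry if $F^*\omega_{D^{IV}_m}=\lambda\omega_{\mathbb{B}^n}$ for a constant $\lambda>0$. For a rational map $F=(P_1,\dots,P_m)/R$ in lowest terms, $\deg(F)=\max\{\deg P_1,\dots,\deg P_m,\deg R\}$. *)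

(* Defs.v *)
From HB Require Import structures.
From mathcomp Require Import all_boot all_order all_algebra.
From mathcomp Require Import mpoly.
From mathcomp Require Import all_classical all_reals all_analysis.
From mathcomp Require Import complex.


Set Implicit Arguments.
Unset Strict Implicit.
Unset Printing Implicit Defensive.

Import Order.TTheory GRing.Theory Num.Theory.
Local Open Scope ring_scope.
Local Open Scope complex_scope.

Section Defs.
Context {R : realType}.
Local Notation C := R[i].

Definition cpt (n : nat) := 'I_n -> C.

Definition csq (w : C) : R := complex.Re w ^+ 2 + complex.Im w ^+ 2.

Definition vnormsq {n} (z : cpt n) : R := \sum_(j < n) csq (z j).

Definition vsqsum {n} (z : cpt n) : C := \sum_(j < n) z j ^+ 2.

Definition in_ball {n} (z : cpt n) : Prop := vnormsq z < 1.

Definition rhoIV {m} (z : cpt m) : R := 1 - vnormsq z + 4^-1 * csq (vsqsum z).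

Definition in_DIV {m} (z : cpt m) : Prop := vnormsq z < 2 /\ 0 < rhoIV z.

(* Bergman kernels (on the diagonal), normalising constants c, c' taken = 1;
   they do not affect omega = i ddbar log K. *)
Definition bergman_ball {n} (z : cpt n) : R := (1 - vnormsq z) ^- n.+1.
Definition bergman_DIV {m} (z : cpt m) : R := (rhoIV z) ^- m.

Definition shift {n} (z : cpt n) (j : 'I_n) (w : C) : cpt n :=
  fun k => if k == j then z k + w else z k.

Definition dx {n} (j : 'I_n) (phi : cpt n -> R) : cpt n -> R :=
  fun z => derive1 (fun t : R => phi (shift z j (t +i* 0))) 0.
Definition dy {n} (j : 'I_n) (phi : cpt n -> R) : cpt n -> R :=
  fun z => derive1 (fun t : R => phi (shift z j (0 +i* t))) 0.

Definition dxc {n} (j : 'I_n) (f : cpt n -> C) : cpt n -> C :=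
  fun z => dx j (fun w => complex.Re (f w)) z +i* dx j (fun w => complex.Im (f w)) z.
Definition dyc {n} (j : 'I_n) (f : cpt n -> C) : cpt n -> C :=
  fun z => dy j (fun w => complex.Re (f w)) z +i* dy j (fun w => complex.Im (f w)) z.

Definition dz {n} (j : 'I_n) (f : cpt n -> C) : cpt n -> C :=
  fun z => (2^-1 +i* 0) * (dxc j f z - 'i * dyc j f z).

(* d^2 phi / dz_i d\bar z_j for a real function phi *)
Definition ddbar {n} (phi : cpt n -> R) (z : cpt n) (i j : 'I_n) : C :=
  (4^-1 +i* 0) *
  ((dx i (dx j phi) z + dy i (dy j phi) z) +i*
   (dx i (dy j phi) z - dy i (dx j phi) z)).

(* Bergman metrics omega = sqrt(-1) ddbar log K, given by their
   coefficient matrices g_{i \bar j} *)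
Definition omega_ball {n} (z : cpt n) (i j : 'I_n) : C :=
  ddbar (fun w => ln (bergman_ball w)) z i j.
Definition omega_DIV {m} (w : cpt m) (k l : 'I_m) : C :=
  ddbar (fun u => ln (bergman_DIV u)) w k l.

(* pull-back of a (1,1)-form sqrt(-1) sum g_{k\bar l} dw_k /\ d\bar w_l by a
   holomorphic map F: coefficients sum_{k,l} g_{k\bar l}(F z) dF_k/dz_i
   conj(dF_l/dz_j) *)
Definition pullback {n m} (g : cpt m -> 'I_m -> 'I_m -> C)
  (F : cpt n -> cpt m) (z : cpt n) (i j : 'I_n) : C :=
  \sum_(k < m) \sum_(l < m)
     g (F z) k l * dz i (fun w => F w k) z * conjc (dz j (fun w => F w l) z).

Definition holo_isometry {n m} (F : cpt n -> cpt m) : Prop :=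
  exists lambda : R, 0 < lambda /\
    forall z : cpt n, in_ball z -> forall i j : 'I_n,
      pullback omega_DIV F z i j = (lambda +i* 0) * omega_ball z i j.

Local Notation cpoly n := (mpoly.mpoly n C).

Definition peval {n} (z : cpt n) (p : cpoly n) : C := mpoly.meval z p.

Definition rat_rep {n m} (F : cpt n -> cpt m) (P : 'I_m -> cpoly n)
  (Q : cpoly n) : Prop :=
  forall z : cpt n, in_ball z ->
    peval z Q != 0 /\ forall k, F z k = peval z (P k) / peval z Q.

Definition pdvd {n} (q p : cpoly n) : Prop := exists s : cpoly n, p = q * s.

Definition lowest_terms {n m} (P : 'I_m -> cpoly n) (Q : cpoly n) : Prop :=
  forall q : cpoly n, pdvd q Q -> (forall k, pdvd q (P k)) ->
    (mpoly.msize q <= 1)%N.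

Definition is_rational_map {n m} (F : cpt n -> cpt m) : Prop :=
  exists (P : 'I_m -> cpoly n) (Q : cpoly n), rat_rep F P Q.

(* deg F = max (deg P_1, ..., deg P_m, deg Q); total degree = msize - 1 *)
Definition rat_deg {n m} (P : 'I_m -> cpoly n) (Q : cpoly n) : nat :=
  maxn (\max_(k < m) (mpoly.msize (P k)).-1) (mpoly.msize Q).-1.

End Defs.

(* Main.v *)
Require Import Defs.
From HB Require Import structures.
From mathcomp Require Import all_boot all_order all_algebra.
From mathcomp Require Import mpoly.
From mathcomp Require Import all_classical all_reals all_analysis.
From mathcomp Require Import complex ring lra.

(** Write [f = P / Q] and [rho(z, w) = 1 - f(z).conj f(w) + h(z) conj h(w)] with
    [h = (f.f) / 2].  The isometry condition says that [log rho(z, z)] and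
    [kappa log (1 - |z|^2)] have the same complex Hessian.  Both sides are rational in
    [z] and [conj z], so the identity polarizes to independent [z] and [w]; two
    integrations, in [w] from [0] and then in [z] from [0], give
    [rho(z, w) = (1 - z.conj w)^kappa] when [z.conj w] is real, and for all [z], [w] when
    [kappa = 1].  At the points [e_j / 2] the components of [f] normal to the image of
    [A = f'(0)] have Gram matrix [gamma I + h h^*], where
    [gamma = 1 - kappa / 4 - (3/4)^kappa].  If [kappa > 1] then [gamma < 0], impossible as
    [h h^*] has rank one; if [kappa < 1] then [gamma > 0] and these [n] components are
    independent in a space of dimension [m - n < n].  Hence [kappa = 1], and
    [<f(z), f(w)> = <z, w> + h(z) conj h(w)] forces [f = A z + h u] with [A] isometric and
    [u] a unit vector normal to its image.  Expanding [f.f = 2 h] gives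
    [c h^2 + 2 (l - 1) h + q = 0] with [q = Az.Az], [l = Az.u], [c = u.u].  Here [q != 0]
    because [2 n > m] excludes an isotropic image of [A].  As [h] is rational, the
    discriminant of this equation is a square on each complex line, which forces [c q = 0].
    So [c = 0], [h = q / (2 (1 - l))], and [f] has degree two. *)

Set Implicit Arguments.
Unset Strict Implicit.
Unset Printing Implicit Defensive.

Import Order.TTheory GRing.Theory Num.Theory numFieldNormedType.Exports.
Local Open Scope ring_scope.
Local Open Scope complex_scope.
Local Open Scope classical_set_scope.
(* Inside big operators [x^*] would parse as [Num.conj]. *)
Local Notation "x ^J" := (conjc x) (at level 2, left associativity, format "x ^J").

(** * Derivatives of complex-valued functions of a real variable *)

Section ComplexDerivative.
Context {R : realType}.
Local Notation C := R[i].
Local Notation Re := (@complex.Re R).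
Local Notation Im := (@complex.Im R).
Implicit Types (f g : R -> C) (t : R) (d e : C).

Lemma complexP (x y : C) : Re x = Re y -> Im x = Im y -> x = y.
Proof. by case: x y => a b [c d] /= -> ->. Qed.

Lemma ReD (x y : C) : Re (x + y) = Re x + Re y. Proof. by case: x y => a b []. Qed.
Lemma ImD (x y : C) : Im (x + y) = Im x + Im y. Proof. by case: x y => a b []. Qed.
Lemma ReN (x : C) : Re (- x) = - Re x. Proof. by case: x. Qed.
Lemma ImN (x : C) : Im (- x) = - Im x. Proof. by case: x. Qed.
Lemma ReM (x y : C) : Re (x * y) = Re x * Re y - Im x * Im y.
Proof. by case: x y => a b []. Qed.
Lemma ImM (x y : C) : Im (x * y) = Re x * Im y + Im x * Re y.
Proof. by case: x y => a b []. Qed.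
Lemma ReJ (x : C) : Re x^J = Re x. Proof. by case: x. Qed.
Lemma ImJ (x : C) : Im x^J = - Im x. Proof. by case: x. Qed.
Lemma Re_sum (I : Type) (r : seq I) (P : pred I) (F : I -> C) :
  Re (\sum_(i <- r | P i) F i) = \sum_(i <- r | P i) Re (F i).
Proof. exact: (big_morph _ ReD). Qed.

(** Componentwise, to match [dxc] and [dyc]. Holomorphic functions are only ever differentiated
    along real-parametrized lines, so this derivative suffices throughout. *)
Definition cderive f t d : Prop :=
  is_derive t (1 : R) (fun x => Re (f x)) (Re d) /\
  is_derive t (1 : R) (fun x => Im (f x)) (Im d).

Lemma cderive_eq f t d e : cderive f t d -> d = e -> cderive f t e.
Proof. by move=> ? <-. Qed.

Lemma cderive_unique f t d e : cderive f t d -> cderive f t e -> d = e.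
Proof.
move=> [[_ d1] [_ d2]] [[_ e1] [_ e2]].
by apply: complexP; rewrite -?d1 -?d2 -?e1 -?e2.
Qed.

Lemma near_eq_cderive f g t d :
  (\near t, f t = g t) -> cderive f t d -> cderive g t d.
Proof.
move=> fg [h1 h2]; split.
- by apply: near_eq_is_derive h1; near do (congr Re).
- by apply: near_eq_is_derive h2; near do (congr Im).
Unshelve. all: by end_near. Qed.

Lemma cderive_cst (c : C) t : cderive (fun=> c) t 0.
Proof. by split; exact: is_derive_cst. Qed.

Lemma cderive_id t : cderive (fun x => x%:C) t 1.
Proof. by split; [exact: is_derive_id | exact: is_derive_cst]. Qed.

Lemma cderiveD f g t d e : cderive f t d -> cderive g t e ->
  cderive (fun x => f x + g x) t (d + e).
Proof.
move=> [f1 f2] [g1 g2]; split.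
- under [X in is_derive _ _ X]eq_fun do rewrite ReD.
  by rewrite ReD; exact: is_deriveD.
- under [X in is_derive _ _ X]eq_fun do rewrite ImD.
  by rewrite ImD; exact: is_deriveD.
Qed.

Lemma cderiveN f t d : cderive f t d -> cderive (fun x => - f x) t (- d).
Proof.
move=> [f1 f2]; split.
- under [X in is_derive _ _ X]eq_fun do rewrite ReN.
  by rewrite ReN; exact: is_deriveN.
- under [X in is_derive _ _ X]eq_fun do rewrite ImN.
  by rewrite ImN; exact: is_deriveN.
Qed.

Lemma cderiveJ f t d : cderive f t d -> cderive (fun x => (f x)^J) t d^J.
Proof.
move=> [f1 f2]; split.
- under [X in is_derive _ _ X]eq_fun do rewrite ReJ.
  by rewrite ReJ.
- under [X in is_derive _ _ X]eq_fun do rewrite ImJ.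
  by rewrite ImJ; exact: is_deriveN.
Qed.

Lemma cderiveB f g t d e : cderive f t d -> cderive g t e ->
  cderive (fun x => f x - g x) t (d - e).
Proof. by move=> hf hg; apply: cderiveD => //; exact: cderiveN. Qed.

Lemma cderiveM f g t d e : cderive f t d -> cderive g t e ->
  cderive (fun x => f x * g x) t (d * g t + f t * e).
Proof.
move=> [f1 f2] [g1 g2]; split.
- under [X in is_derive _ _ X]eq_fun do rewrite ReM.
  apply: is_derive_eq (is_deriveB (is_deriveM f1 g1) (is_deriveM f2 g2)) _.
  by rewrite ReD !ReM /GRing.scale /=; ring.
- under [X in is_derive _ _ X]eq_fun do rewrite ImM.
  apply: is_derive_eq (is_deriveD (is_deriveM f1 g2) (is_deriveM f2 g1)) _.
  by rewrite ImD !ImM /GRing.scale /=; ring.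
Qed.

Lemma cderiveZ (c : C) f t d : cderive f t d -> cderive (fun x => c * f x) t (c * d).
Proof.
move=> hf; apply: cderive_eq (cderiveM (cderive_cst c t) hf) _.
by rewrite mul0r add0r.
Qed.

Lemma cderive_sum (I : Type) (r : seq I) (F : I -> R -> C) (D : I -> C) t :
  (forall i, cderive (F i) t (D i)) ->
  cderive (fun x => \sum_(i <- r) F i x) t (\sum_(i <- r) D i).
Proof.
move=> h; elim: r => [|i r IH].
  rewrite big_nil; under [X in cderive X]eq_fun do rewrite big_nil.
  exact: cderive_cst.
rewrite big_cons; under [X in cderive X]eq_fun do rewrite big_cons.
exact: cderiveD.
Qed.

Lemma cderive_real (h : R -> R) t (d : R) :
  is_derive t (1 : R) h d -> cderive (fun x => (h x)%:C) t d%:C.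
Proof. by move=> hd; split => //=; exact: is_derive_cst. Qed.

Lemma csqE (x : C) : (csq x)%:C = x * x^J.
Proof. by apply: complexP; case: x => a b /=; rewrite /csq /=; ring. Qed.

Lemma csq_eq0 (x : C) : (csq x == 0) = (x == 0).
Proof.
by rewrite /csq paddr_eq0 ?sqr_ge0 // !sqrf_eq0 eq_complex.
Qed.

Lemma csq_ge0 (x : C) : 0 <= csq x.
Proof. by rewrite addr_ge0 ?sqr_ge0. Qed.

Lemma csqM (x y : C) : csq (x * y) = csq x * csq y.
Proof. by case: x y => a b [c d]; rewrite /csq /=; ring. Qed.

Lemma is_derive_Re f t d : cderive f t d -> is_derive t (1 : R) (fun x => Re (f x)) (Re d).
Proof. by case. Qed.

Lemma is_derive_csq f t d : cderive f t d ->
  is_derive t (1 : R) (fun x => csq (f x)) (2 * Re (d * (f t)^J)).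
Proof.
move=> hf; have -> : (fun x => csq (f x)) = fun x => Re (f x * (f x)^J).
  by apply/funext => x; rewrite -csqE.
apply: is_derive_eq (is_derive_Re (cderiveM hf (cderiveJ hf))) _.
by rewrite ReD !ReM ReJ ImJ ReJ ImJ; ring.
Qed.

Lemma cderiveV f t d : f t != 0 -> cderive f t d ->
  cderive (fun x => (f x)^-1) t (- d / (f t) ^+ 2).
Proof.
move=> ft0 hf.
(* Writing [x^-1] as the conjugate over [csq x] reduces the claim to the inverse of a real
   function. *)
have Vc (x : C) : x^-1 = x^J * ((csq x)^-1)%:C.
  have [->|x0] := eqVneq x 0; first by rewrite invr0 rmorph0 mul0r.
  by rewrite fmorphV /= csqE invfM mulrA mulrAC divff ?mul1r // ?conjc_eq0 //.
have -> : (fun x => (f x)^-1) = fun x => (f x)^J * ((csq (f x))^-1)%:C.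
  by apply/funext => x; rewrite Vc.
have c0 : csq (f t) != 0 by rewrite csq_eq0.
have h := (cderiveM (cderiveJ hf) (cderive_real (@is_deriveV _ (fun x => csq (f x)) _ _ _ c0 (is_derive_csq hf)))).
apply: cderive_eq h _.
rewrite /GRing.scale /= !(rmorphM, rmorphN, fmorphV, rmorphXn) /= csqE ReJ_add.
rewrite rmorphM /= conjcK.
have fc0 : (f t)^J != 0 by rewrite conjc_eq0.
rewrite (_ : 2%:C = 2); last by rewrite -(rmorph_nat (real_complex R)).
by field; rewrite ft0.
Qed.

Lemma cderive_div f g t d e : g t != 0 -> cderive f t d -> cderive g t e ->
  cderive (fun x => f x / g x) t ((d * g t - f t * e) / g t ^+ 2).
Proof.
move=> gt0 hf hg; apply: cderive_eq (cderiveM hf (cderiveV gt0 hg)) _.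
by field.
Qed.

Lemma is_derive_continuous (h : R -> R) t (d : R) :
  is_derive t (1 : R) h d -> {for t, continuous h}.
Proof.
move=> hd; apply/differentiable_continuous/derivable1_diffP.
exact: ex_derive.
Qed.

Lemma cderive_near_neq0 f t d : cderive f t d -> f t != 0 -> \near t, f t != 0.
Proof.
move=> hf ft0; have /is_derive_continuous ct := is_derive_csq hf.
have pos : 0 < csq (f t) by rewrite lt_def csq_eq0 ft0 csq_ge0.
have hn : \near t, 0 < csq (f t) by exact: ct _ (lt_nbhsr pos).
by near=> x; rewrite -csq_eq0 gt_eqF //; near: x.
Unshelve. all: by end_near. Qed.

(** The mean value theorem is applied to the real and the imaginary part separately, since it fails
    for complex values. *)
Lemma cderive0_cst f (a b : R) : a <= b ->
  (forall t, a <= t <= b -> cderive f t 0) -> f a = f b.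
Proof.
move=> ab h.
have aux (u : R -> R) : (forall t, a <= t <= b -> is_derive t (1 : R) u 0) -> u a = u b.
  move=> hu.
  have hd x : x \in `]a, b[%R -> is_derive x (1 : R) u ((fun=> 0) x).
    by rewrite in_itv /= => /andP[/ltW ax /ltW xb]; apply: hu; rewrite ax xb.
  have hc : {within `[a, b], continuous u}.
    apply/continuous_in_subspaceT => x; rewrite inE /= in_itv /= => xab.
    exact: is_derive_continuous (hu _ xab).
  by have [c _] := MVT_segment ab hd hc; rewrite mul0r => /eqP; rewrite subr_eq0 => /eqP/esym.
by apply: complexP; [apply: (aux (fun x => Re (f x))) | apply: (aux (fun x => Im (f x)))] => t /h [].
Qed.

End ComplexDerivative.

(** * Polynomials along lines and their zeros near the origin *)

Section Polynomials.
Context {R : realType}.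
Local Notation C := R[i].
Local Notation cpoly n := (mpoly.mpoly n C).
Local Notation cpt := (@cpt R).

(** Constants and variables generate the polynomial ring, so a property stable under sums and
    products need only be checked on them. *)
Lemma mpoly_ring_ind (n : nat) (P : cpoly n -> Prop) :
  (forall c, P (mpolyC n c)) -> (forall i, P (mpolyX C U_(i)%MM)) ->
  (forall p q, P p -> P q -> P (p + q)) -> (forall p q, P p -> P q -> P (p * q)) ->
  forall p, P p.
Proof.
move=> hC hX hD hM; elim/mpolyind => [|c m p _ _ IH].
  by rewrite -mpolyC0.
apply: (hD) => //; rewrite -mul_mpolyC; apply: (hM) => //.
rewrite mpolyXE_id; elim/big_ind: _ => [|p1 p2|i _]; [by rewrite -mpolyC1 | exact: hM |].
by elim: (m i) => [|k IHk]; rewrite ?expr0 -?mpolyC1 // exprS; apply: (hM).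
Qed.

Definition cline n (a b : cpt n) (s : C) : cpt n := fun k => a k + s * b k.

Lemma cderive_cline n (a b : cpt n) k t : cderive (fun x => cline a b x%:C k) t (b k).
Proof.
apply: cderive_eq (cderiveD (cderive_cst (a k) t) (cderiveM (cderive_id t) (cderive_cst (b k) t))) _.
by rewrite mulr0 add0r addr0 mul1r.
Qed.

Lemma cderive_peval n (a b : cpt n) (p : cpoly n) t :
  cderive (fun x => peval (cline a b x%:C) p) t
    (\sum_i b i * peval (cline a b t%:C) (mderiv i p)).
Proof.
elim/mpoly_ring_ind: p => [c|i|p q hp hq|p q hp hq].
- have -> : (fun x => peval (cline a b x%:C) (mpolyC n c)) = fun=> c.
    by apply/funext => x; rewrite /peval mevalC.
  rewrite big1 ?cderive_cst // => [|i _]; first exact: cderive_cst.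
  by rewrite mderivC /peval meval0 mulr0.
- have -> : (fun x => peval (cline a b x%:C) (mpolyX C U_(i)%MM)) = fun x => cline a b x%:C i.
    by apply/funext => x; rewrite /peval mevalXU.
  apply: cderive_eq (cderive_cline _ _ _ _) _.
  rewrite (bigD1 i) //= big1 => [|j ji].
    rewrite addr0 mderivX mnm1E eqxx /peval mevalZ.
    rewrite (_ : (U_(i) - U_(i))%MM = 0%MM) ?mpolyX0 ?meval1 ?mulr1 //.
    by apply/mnmP => j; rewrite mnmBE mnm0E subnn.
  by rewrite mderivX mnm1E eq_sym (negbTE ji) /peval mevalZ mul0r mulr0.
- have -> : (fun x => peval (cline a b x%:C) (p + q)) =
            fun x => peval (cline a b x%:C) p + peval (cline a b x%:C) q.
    by apply/funext => x; rewrite /peval mevalD.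
  apply: cderive_eq (cderiveD hp hq) _.
  by rewrite -big_split; apply: eq_bigr => i _; rewrite /= mderivD /peval mevalD mulrDr.
- have -> : (fun x => peval (cline a b x%:C) (p * q)) =
            fun x => peval (cline a b x%:C) p * peval (cline a b x%:C) q.
    by apply/funext => x; rewrite /peval mevalM.
  apply: cderive_eq (cderiveM hp hq) _.
  rewrite mulr_suml mulr_sumr -big_split; apply: eq_bigr => i _.
  by rewrite /= mderivM /peval mevalD !mevalM mulrDr; ring.
Qed.

Lemma vnormsqE n (z : cpt n) : (vnormsq z)%:C = \sum_j z j * (z j)^J.
Proof.
rewrite /vnormsq (rmorph_sum (real_complex R)); apply: eq_bigr => j _ /=.
exact: csqE.
Qed.

Lemma vnormsq_ge0 n (z : cpt n) : 0 <= vnormsq z.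
Proof. by apply: sumr_ge0 => j _; exact: csq_ge0. Qed.

Lemma is_derive_near_lt (h : R -> R) t (d c : R) :
  is_derive t (1 : R) h d -> h t < c -> \near t, h t < c.
Proof. by move=> /is_derive_continuous ch hc; exact: ch _ (lt_nbhsl hc). Qed.

Lemma cderive_near_lt (f : R -> C) (h : R -> R) t d c :
  (forall x, (h x)%:C = f x) -> cderive f t d -> h t < c -> \near t, h t < c.
Proof.
move=> hf [df _]; apply: (is_derive_near_lt (d := complex.Re d)).
by have -> : h = fun x => complex.Re (f x) by apply/funext => x; rewrite -hf.
Qed.

Lemma near_in_ball n (a b : cpt n) (t : R) :
  in_ball (cline a b t%:C) -> \near t, in_ball (cline a b t%:C).
Proof.
move=> h; pose f (x : R) := \sum_j cline a b x%:C j * (cline a b x%:C j)^J.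
apply: (@cderive_near_lt f) h; first by move=> x; rewrite vnormsqE.
apply: cderive_sum => j; apply: cderiveM; last apply: cderiveJ; exact: cderive_cline.
Qed.

Lemma poly_near0_eq0 (p : {poly C}) : (\forall t \near (0 : R), p.[t%:C] = 0) -> p = 0.
Proof.
move=> /nbhs_ballP [e /= e0 he]; apply/eqP; apply/negPn/negP => p0.
(* Distinct roots, as many as [size p]; the denominators start at 2 so that each lies strictly
   within [e] of 0. *)
pose r k : C := (e / k.+2%:R)%:C.
have rr k : p.[r k] = 0.
  apply: he; rewrite /ball /= sub0r normrN gtr0_norm ?divr_gt0 ?ltr0n //.
  by rewrite ltr_pdivrMr ?ltr0n // ltr_pMr // ltr1n.
have := @max_poly_roots _ p [seq r k | k <- iota 0 (size p)] p0.
rewrite size_map size_iota ltnn => h; suff : false by []; apply: h.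
  by apply/allP => _ /mapP [k _ ->]; rewrite /root rr.
rewrite map_inj_uniq ?iota_uniq // => k l /complexI /(mulfI (lt0r_neq0 e0)).
by move=> /invr_inj /eqP; rewrite eqr_nat => /eqP [].
Qed.

End Polynomials.

(** * Sesquirational functions and polarization from the diagonal *)

Section Polarization.
Context {R : realType}.
Local Notation C := R[i].
Local Notation cpoly n := (mpoly.mpoly n C).
Local Notation cpt := (@cpt R).

Lemma cline0 n (a b : cpt n) : cline a b 0 = a.
Proof. by apply/funext => k; rewrite /cline mul0r addr0. Qed.

Lemma in_ball0 n : in_ball ((fun=> 0) : cpt n).
Proof.
by rewrite /in_ball /vnormsq big1 ?ltr01 // => i _; rewrite /csq /= expr0n addr0.
Qed.

Lemma mnm_gt0 n (m : 'X_{1..n}) : m != 0%MM -> exists i, (0 < m i)%N.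
Proof.
move=> m0; apply/existsP; move: m0; apply: contraNT; rewrite negb_exists.
move=> /forallP h; apply/eqP/mnmP => i; rewrite mnm0E.
by apply/eqP; move: (h i); rewrite -leqNgt leqn0.
Qed.

(** Induction on the degree of the monomial: the constant coefficient is the value at 0, and a
    partial derivative again vanishes on the ball while its coefficients are nonzero integer
    multiples of those of [p]. *)
Lemma cpoly_ball_eq0 n (p : cpoly n) :
  (forall z, in_ball z -> peval z p = 0) -> p = 0.
Proof.
move=> h; apply/mpolyP => m; rewrite mcoeff0.
have [d] := ubnP (mdeg m); elim: d m p h => // d IH m p h md.
have b0 := in_ball0 n.
have [m0|] := eqVneq m 0%MM.
  have := h _ b0; rewrite /peval mevalE m0.
  have -> : \sum_(m1 <- msupp p) p@_m1 * \prod_i (0 : C) ^+ m1 i = p@_0.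
    have z0 m1 : m1 != 0%MM -> \prod_(i < n) (0 : C) ^+ m1 i = 0.
      move=> /mnm_gt0 [i mi]; apply/eqP/prodf_eq0; exists i => //.
      by rewrite expf_eq0 mi eqxx.
    have [s0|s0] := boolP (0%MM \in msupp p).
      rewrite (bigD1_seq 0%MM) //= ?msupp_uniq // [X in _ + X]big1 => [|m1 m10].
        by rewrite addr0 big1 ?mulr1 // => i _; rewrite mnm0E expr0.
      by rewrite z0 ?mulr0.
    rewrite (memN_msupp_eq0 s0) big_seq big1 // => m1 m1s.
    by rewrite z0 ?mulr0 //; apply: contraNneq s0 => <-.
  by [].
move=> /mnm_gt0 [i mi].
have em : m = (m - U_(i) + U_(i))%MM.
  by rewrite submK //; apply/mnm_lepP => j; rewrite mnm1E; case: eqP => [<-|].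
have : (mderiv i p)@_(m - U_(i))%MM = 0.
  apply: IH => [z hz|]; last first.
    by move: md; rewrite em mdegD mdeg1 addn1 ltnS -em.
  pose e : cpt n := fun k => (k == i)%:R.
  have c1 := cderive_peval z e p 0.
  have nb : \forall t \near (0 : R), in_ball (cline z e t%:C).
    by apply: near_in_ball; rewrite cline0.
  have c2 : cderive (fun x => peval (cline z e x%:C) p) 0 0.
    apply: near_eq_cderive (cderive_cst 0 0).
    by near=> t; rewrite h //; near: t.
  have := cderive_unique c1 c2; rewrite cline0 (bigD1 i) //= big1 => [|k ki].
    by rewrite addr0 /e eqxx mul1r.
  by rewrite /e (negbTE ki) mul0r.
rewrite mcoeff_mderiv -em => /eqP; rewrite mulrn_eq0 => /orP[|/eqP //].
by rewrite /=.
Unshelve. all: by end_near. Qed.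

(** Parallelogram identity, which makes the ball stable under midpoints. *)
Lemma csq_mid (x y : C) : csq ((x + y) / 2) + csq ((x - y) / 2) = (csq x + csq y) / 2.
Proof.
have -> : (2 : C)^-1 = (2^-1)%:C by rewrite fmorphV rmorph_nat.
by case: x y => a b [c d]; rewrite /csq /=; field.
Qed.

Lemma in_ball_mid n (z w : cpt n) :
  in_ball z -> in_ball w -> in_ball (fun k => (z k + w k) / 2).
Proof.
rewrite /in_ball => hz hw.
have : vnormsq (fun k => (z k + w k) / 2) <= (vnormsq z + vnormsq w) / 2.
  rewrite /vnormsq -big_split /= mulr_suml; apply: ler_sum => k _.
  by rewrite -csq_mid lerDl csq_ge0.
by move=> h; apply: le_lt_trans h _; lra.
Qed.

Lemma in_ball_scale n (z : cpt n) (t : R) :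
  0 <= t <= 1 -> in_ball z -> in_ball (fun k => t%:C * z k).
Proof.
move=> /andP[t0 t1]; rewrite /in_ball; apply: le_lt_trans; rewrite /vnormsq.
apply: ler_sum => k _; rewrite csqM ler_piMl ?csq_ge0 // /csq /= expr0n addr0.
by rewrite expr_le1.
Qed.

Lemma peval_cline_poly n (a b : cpt n) (P : cpoly n) :
  exists p : {poly C}, forall s, peval (cline a b s) P = p.[s].
Proof.
elim/(@mpoly_ring_ind R): P => [c|i|p q [u hu] [v hv]|p q [u hu] [v hv]].
- by exists c%:P => s; rewrite /peval mevalC hornerC.
- by exists ((a i)%:P + 'X * (b i)%:P) => s; rewrite /peval mevalXU !hornerE.
- by exists (u + v) => s; rewrite hornerD -hu -hv /peval mevalD.
- by exists (u * v) => s; rewrite hornerM -hu -hv /peval mevalM.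
Qed.

Definition hdot n (z w : cpt n) : C := \sum_j z j * (w j)^J.

(** The real part of [hdot z w] is at most the mean of the two squared norms, hence below 1. *)
Lemma hdot_neq1 n (z w : cpt n) : in_ball z -> in_ball w -> 1 - hdot z w != 0.
Proof.
rewrite /in_ball => hz hw; apply/eqP => /(congr1 (@complex.Re R)).
rewrite ReD ReN /hdot Re_sum /=.
have : \sum_j complex.Re (z j * (w j)^J) <= (vnormsq z + vnormsq w) / 2.
  rewrite /vnormsq -big_split /= mulr_suml; apply: ler_sum => k _.
  case: (z k) (w k) => a b [c d]; rewrite /csq /=.
  have := sqr_ge0 (a - c); have := sqr_ge0 (b - d); nra.
by lra.
Qed.

(** Rationality in [z] and in the conjugate of [w], tested on lines. The parameter of the second
    line is conjugated, so that antiholomorphic dependence on [w] also becomes rational in [s]; an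
    identity then reduces to the vanishing of a one-variable numerator. *)
Definition sesquirational n (E : cpt n -> cpt n -> C) : Prop :=
  forall a b a' b' : cpt n, exists p q : {poly C}, forall s : C,
    in_ball (cline a b s) -> in_ball (cline a' b' s^J) ->
    q.[s] != 0 /\ E (cline a b s) (cline a' b' s^J) = p.[s] / q.[s].

Section Closure.
Variable n : nat.
Implicit Types E G : cpt n -> cpt n -> C.

Lemma sesquirational_poly E :
  (forall a b a' b', exists p : {poly C}, forall s,
     E (cline a b s) (cline a' b' s^J) = p.[s]) -> sesquirational E.
Proof.
move=> h a b a' b'; have [p hp] := h a b a' b'.
by exists p, 1 => s _ _; rewrite hornerC oner_eq0 divr1.
Qed.

Lemma sesquirational_cst c : sesquirational (fun _ _ : cpt n => c).
Proof. by apply: sesquirational_poly => *; exists c%:P => s; rewrite hornerC. Qed.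

Lemma sesquirationalD E G : sesquirational E -> sesquirational G ->
  sesquirational (fun z w => E z w + G z w).
Proof.
move=> hE hG a b a' b'.
have [p [q h]] := hE a b a' b'; have [p' [q' h']] := hG a b a' b'.
exists (p * q' + p' * q), (q * q') => s s1 s2.
have [q0 ->] := h s s1 s2; have [q0' ->] := h' s s1 s2.
by rewrite hornerD !hornerM mulf_neq0 // addf_div.
Qed.

Lemma sesquirationalM E G : sesquirational E -> sesquirational G ->
  sesquirational (fun z w => E z w * G z w).
Proof.
move=> hE hG a b a' b'.
have [p [q h]] := hE a b a' b'; have [p' [q' h']] := hG a b a' b'.
exists (p * p'), (q * q') => s s1 s2.
have [q0 ->] := h s s1 s2; have [q0' ->] := h' s s1 s2.
by rewrite !hornerM mulf_neq0 // mulf_div.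
Qed.

Lemma sesquirationalN E : sesquirational E -> sesquirational (fun z w => - E z w).
Proof.
move=> hE; have -> : (fun z w => - E z w) = (fun z w => (-1) * E z w).
  by apply/funext => z; apply/funext => w; rewrite mulN1r.
by apply: sesquirationalM => //; exact: sesquirational_cst.
Qed.

Lemma sesquirationalB E G : sesquirational E -> sesquirational G ->
  sesquirational (fun z w => E z w - G z w).
Proof. by move=> hE hG; apply: sesquirationalD => //; exact: sesquirationalN. Qed.

Lemma sesquirationalX E k : sesquirational E -> sesquirational (fun z w => E z w ^+ k).
Proof.
move=> hE; elim: k => [|k IH].
  by have -> : (fun z w => E z w ^+ 0) = fun _ _ => 1 by []; exact: sesquirational_cst.
have -> : (fun z w => E z w ^+ k.+1) = (fun z w => E z w * E z w ^+ k).
  by apply/funext => z; apply/funext => w; rewrite exprS.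
exact: sesquirationalM.
Qed.

Lemma sesquirational_sum (I : Type) (r : seq I) (F : I -> cpt n -> cpt n -> C) :
  (forall i, sesquirational (F i)) -> sesquirational (fun z w => \sum_(i <- r) F i z w).
Proof.
move=> hF; elim: r => [|i r IH].
  have -> : (fun z w => \sum_(i <- [::]) F i z w) = fun _ _ => 0.
    by apply/funext => z; apply/funext => w; rewrite big_nil.
  exact: sesquirational_cst.
have -> : (fun z w => \sum_(j <- i :: r) F j z w) =
          (fun z w => F i z w + \sum_(j <- r) F j z w).
  by apply/funext => z; apply/funext => w; rewrite big_cons.
exact: sesquirationalD.
Qed.

(** Exchanging the arguments turns [s] into its conjugate; conjugating the coefficients restores a
    rational function of [s]. *)
Lemma sesquirationalJ E : sesquirational E -> sesquirational (fun z w => (E w z)^J).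
Proof.
move=> hE a b a' b'; have [p [q h]] := hE a' b' a b.
exists (map_poly conjc p), (map_poly conjc q) => s s1 s2.
have := h s^J; rewrite conjcK => /(_ s2 s1) [q0 ->].
have hc (u : {poly C}) : (map_poly conjc u).[s] = (u.[s^J])^J.
  by rewrite -{1}[s]conjcK horner_map.
by rewrite !hc conjc_eq0 q0 -conjc_inv -rmorphM.
Qed.

Lemma sesquirationalV E : sesquirational E ->
  (forall z w, in_ball z -> in_ball w -> E z w != 0) ->
  sesquirational (fun z w => (E z w)^-1).
Proof.
move=> hE h0 a b a' b'; have [p [q h]] := hE a b a' b'.
exists q, p => s s1 s2; have [q0 e] := h s s1 s2.
have := h0 _ _ s1 s2; rewrite e; split; last by rewrite invf_div.
by move: (h0 _ _ s1 s2); rewrite e mulf_eq0 => /norP[].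
Qed.

Lemma sesquirational_peval (P : cpoly n) : sesquirational (fun z _ => peval z P).
Proof. by apply: sesquirational_poly => a b _ _; exact: peval_cline_poly. Qed.

Lemma sesquirational_coord (k : 'I_n) : sesquirational (fun z _ : cpt n => z k).
Proof.
apply: sesquirational_poly => a b _ _.
by exists ((a k)%:P + 'X * (b k)%:P) => s; rewrite !hornerE.
Qed.

(** Identity theorem: on small real [s], where conjugation is invisible, the numerator vanishes, so
    it is the zero polynomial and [E] vanishes at every admissible complex [s]. *)
Lemma sesquirational_near_eq0 E (a b a' b' : cpt n) (s : C) : sesquirational E ->
  (\forall t \near (0 : R), E (cline a b t%:C) (cline a' b' t%:C) = 0) ->
  in_ball a -> in_ball a' ->
  in_ball (cline a b s) -> in_ball (cline a' b' s^J) ->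
  E (cline a b s) (cline a' b' s^J) = 0.
Proof.
move=> hE e0 ha ha' h1 h2; have [p [q h]] := hE a b a' b'.
suff p0 : p = 0 by have [_ ->] := h _ h1 h2; rewrite p0 horner0 mul0r.
apply: poly_near0_eq0.
have n1 : \forall t \near (0 : R), in_ball (cline a b t%:C).
  by apply: near_in_ball; rewrite cline0.
have n2 : \forall t \near (0 : R), in_ball (cline a' b' t%:C).
  by apply: near_in_ball; rewrite cline0.
near=> t; have [//||q0] := h t%:C; first by near: t.
  by rewrite conjc_real; near: t.
rewrite conjc_real (near e0 t) // => /esym/eqP.
by rewrite mulf_eq0 invr_eq0 (negbTE q0) orbF => /eqP.
Unshelve. all: by end_near. Qed.

(* [z] and [w] are the values at [s = i] and [s = -i] of the complex line through
   their midpoint with direction [(z - w) / 2i]; on real [s] that line stays on the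
   diagonal. *)
Lemma polarization E : sesquirational E ->
  (forall z, in_ball z -> E z z = 0) ->
  forall z w, in_ball z -> in_ball w -> E z w = 0.
Proof.
move=> hE h0 z w hz hw.
pose a : cpt n := fun k => (z k + w k) / 2.
pose b : cpt n := fun k => - ('i : C) * ((z k - w k) / 2).
have ii : ('i : C) * 'i = -1 by rewrite -expr2 sqr_i.
have e1 : cline a b 'i = z.
  by apply/funext => k; rewrite /cline /a /b mulrA mulrN ii; field.
have e2 : cline a b 'i^J = w.
  apply/funext => k; rewrite /cline /a /b mulrA.
  have -> : ('i : C)^J = - 'i by rewrite /= /GRing.opp /= oppr0.
  by rewrite mulrNN ii; field.
have ab : in_ball a by exact: in_ball_mid.
rewrite -e1 -[w in E _ w]e2; apply: sesquirational_near_eq0 => //; rewrite ?e1 ?e2 //.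
have n1 : \forall t \near (0 : R), in_ball (cline a b t%:C).
  by apply: near_in_ball; rewrite cline0.
by near=> t; apply: h0; near: t.
Unshelve. all: by end_near. Qed.

End Closure.
End Polarization.

(** * Complex Hessians of the Bergman potentials *)

Section PotentialDerivatives.
Context {R : realType}.
Local Notation C := R[i].
Local Notation cpoly n := (mpoly.mpoly n C).
Local Notation cpt := (@cpt R).
Local Notation Re := (@complex.Re R).
Local Notation Im := (@complex.Im R).

(* [rhoc a z w] is the polarization, holomorphic in [z] and antiholomorphic in [w], of
   [1 - |z|^2 + a |z.z|^2]: the case [a = 0] is the ball and [a = 1/4] the domain
   [D^IV]. [drho] is its derivative in [z_k], [ddrho] its mixed derivative. *)
Definition rhoc m (a : R) (z w : cpt m) : C :=
  1 - hdot z w + a%:C * (vsqsum z * (vsqsum w)^J).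
Definition drho m (a : R) (z w : cpt m) (k : 'I_m) : C :=
  - (w k)^J + 2 * a%:C * (z k * (vsqsum w)^J).
Definition ddrho m (a : R) (z w : cpt m) (k l : 'I_m) : C :=
  - (k == l)%:R + 4 * a%:C * (z k * (w l)^J).
Definition rho m (a : R) (z : cpt m) : R := 1 - vnormsq z + a * csq (vsqsum z).

Lemma rhoE m a (z : cpt m) : (rho a z)%:C = rhoc a z z.
Proof.
rewrite /rho /rhoc rmorphD rmorphB rmorph1 rmorphM /= vnormsqE csqE //.
Qed.

Lemma conj_double_sum m (v v' : cpt m) :
  (2 * \sum_k v k * v' k)^J = 2 * \sum_k (v k)^J * (v' k)^J.
Proof.
by rewrite rmorphM rmorph_nat rmorph_sum; congr (_ * _); apply: eq_bigr => k _; rewrite rmorphM.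
Qed.

Lemma cderive_vsqsum m (u : R -> cpt m) (u' : cpt m) t :
  (forall k, cderive (fun x => u x k) t (u' k)) ->
  cderive (fun x => vsqsum (u x)) t (2 * \sum_k u t k * u' k).
Proof.
move=> hu; apply: cderive_eq (cderive_sum _ (fun k => cderiveM (hu k) (hu k))) _.
by rewrite mulr_sumr; apply: eq_bigr => k _; ring.
Qed.

Section Paths.
Variables (m : nat) (a : R) (u v : R -> cpt m) (u' v' : cpt m) (t : R).
Hypothesis hu : forall k, cderive (fun x => u x k) t (u' k).
Hypothesis hv : forall k, cderive (fun x => v x k) t (v' k).

(** As [rhoc a z w] is the conjugate of [rhoc a w z], the second argument contributes the conjugate
    of [drho] with the arguments exchanged. *)
Lemma cderive_rhoc : cderive (fun x => rhoc a (u x) (v x)) t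
  (\sum_k drho a (u t) (v t) k * u' k + \sum_k (drho a (v t) (u t) k * v' k)^J).
Proof.
have hd := cderive_sum (index_enum 'I_m) (fun k => cderiveM (hu k) (cderiveJ (hv k))).
have hS := cderiveM (cderive_vsqsum hu) (cderiveJ (cderive_vsqsum hv)).
apply: cderive_eq (cderiveD (cderiveB (cderive_cst 1 t) hd) (cderiveZ a%:C hS)) _.
rewrite conj_double_sum.
rewrite sub0r !(mulr_sumr, mulr_suml) -!big_split /= mulr_sumr -sumrN -big_split /=.
apply: eq_bigr => k _; rewrite /drho !(rmorph_nat, rmorphM, rmorphD, rmorphN) /=.
rewrite !conjcK oppr0 -/(a%:C).
by ring.
Qed.

Lemma cderive_drho k : cderive (fun x => drho a (u x) (v x) k) t
  (2 * a%:C * (u' k * (vsqsum (v t))^J) + \sum_l ddrho a (u t) (v t) k l * (v' l)^J).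
Proof.
have hS := cderiveM (hu k) (cderiveJ (cderive_vsqsum hv)).
apply: cderive_eq (cderiveD (cderiveN (cderiveJ (hv k))) (cderiveZ (2 * a%:C) hS)) _.
rewrite conj_double_sum.
have -> : \sum_l ddrho a (u t) (v t) k l * (v' l)^J =
   - (v' k)^J + \sum_l 4 * a%:C * (u t k * (v t l)^J) * (v' l)^J.
  rewrite (eq_bigr (fun l => - (k == l)%:R * (v' l)^J +
     4 * a%:C * (u t k * (v t l)^J) * (v' l)^J)); last by move=> l _; rewrite mulrDl.
  rewrite big_split /= (bigD1 k) //= eqxx [X in _ + X + _]big1 ?addr0 ?mulN1r // => l lk.
  by rewrite eq_sym (negbTE lk) oppr0 mul0r.
rewrite mulrDr addrCA; congr (_ + (_ + _)).
rewrite !mulr_sumr; apply: eq_bigr => l _; ring.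
Qed.
End Paths.

(** The directions of [dx] and [dy] are [axis 1 j] and [axis 'i j]; keeping [c] as a parameter
    treats both at once. *)
Definition axis m (c : C) (j : 'I_m) : cpt m := fun k => (k == j)%:R * c.

Lemma axis_sum m (c : C) (j : 'I_m) (F : 'I_m -> C) : \sum_k F k * axis c j k = F j * c.
Proof.
rewrite (bigD1 j) //= big1 => [|k kj]; first by rewrite /axis eqxx mul1r addr0.
by rewrite /axis (negbTE kj) mul0r mulr0.
Qed.

Lemma shift_re m (z : cpt m) j t : Defs.shift z j (t +i* 0) = cline z (axis 1 j) t%:C.
Proof.
apply/funext => k; rewrite /Defs.shift /cline /axis mulr1.
by case: eqP => _; rewrite ?mulr1 // mulr0 addr0.
Qed.

Lemma shift_im m (z : cpt m) j t : Defs.shift z j (0 +i* t) = cline z (axis 'i j) t%:C.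
Proof.
apply/funext => k; rewrite /Defs.shift /cline /axis.
case: eqP => _; last by rewrite mul0r mulr0 addr0.
by rewrite mul1r; congr (_ + _); apply: complexP => /=; ring.
Qed.

Section Potential.
Variables (m p : nat) (a : R).
Implicit Types (z : cpt m).
(** For [a = 0], [p = n.+1] this is the logarithm of the Bergman kernel of the ball; for [a = 4^-1],
    [p = m], that of the target domain. *)
Let pot z : R := ln (rho a z ^- p).

Lemma is_derive_rho z (c : C) j :
  is_derive (0 : R) (1 : R) (fun x => rho a (cline z (axis c j) x%:C))
    (2 * Re (c * drho a z z j)).
Proof.
have h k := cderive_cline z (axis c j) k 0.
have -> : (fun x => rho a (cline z (axis c j) x%:C)) =
   fun x => Re (rhoc a (cline z (axis c j) x%:C) (cline z (axis c j) x%:C)).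
  by apply/funext => x; rewrite -rhoE.
apply: is_derive_eq (is_derive_Re (cderive_rhoc a h h)) _.
rewrite cline0 -rmorph_sum /= axis_sum ReD ReJ [_ * c]mulrC; ring.
Qed.

Lemma near_rho_gt0 z c j : 0 < rho a z ->
  \forall x \near (0 : R), 0 < rho a (cline z (axis c j) x%:C).
Proof.
move=> h0; have /is_derive_continuous hc := is_derive_rho z c j.
by apply: (hc _ (lt_nbhsr _)); rewrite /= cline0.
Qed.

Let der (c : C) j (f : cpt m -> R) z := derive1 (fun x : R => f (cline z (axis c j) x%:C)) 0.

Lemma der_val c j f z d :
  is_derive (0 : R) (1 : R) (fun x => f (cline z (axis c j) x%:C)) d -> der c j f z = d.
Proof. by move=> h; rewrite /der derive1E derive_val. Qed.

Lemma der_pot z c j : 0 < rho a z ->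
  der c j pot z = - (p%:R * (2 * Re (c * drho a z z j)) / rho a z).
Proof.
move=> h0; apply: der_val.
have h1 : is_derive (0 : R) (1 : R) (fun x => ln (rho a (cline z (axis c j) x%:C)))
    ((rho a z)^-1 * (2 * Re (c * drho a z z j))).
  apply: (@is_derive1_comp _ (@ln R)); last exact: is_derive_rho.
  by rewrite cline0; exact: is_derive1_ln.
have h2 := is_derive_eq (is_deriveN (is_deriveZ p%:R h1)) (erefl _).
have h3 : is_derive (0 : R) (1 : R) (fun x => pot (cline z (axis c j) x%:C))
    (- (p%:R *: ((rho a z)^-1 * (2 * Re (c * drho a z z j))))).
  apply: near_eq_is_derive h2.
  (* The expansion of the logarithm of the power uses positivity of [rho], which is available only
     for small [x]. *)
  near=> x; rewrite /pot; have r0 : 0 < rho a (cline z (axis c j) x%:C).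
    by near: x; exact: near_rho_gt0.
  rewrite lnV ?posrE ?exprn_gt0 // lnXn //.
  by rewrite -(mulr_natl (ln _)) /GRing.scale /=.
by apply: is_derive_eq h3 _; rewrite /GRing.scale /=; ring.
Unshelve. all: by end_near. Qed.

(** The term with [b^J] is the mixed derivative; the term with [b] is the pure holomorphic second
    derivative, which disappears from [ddbar]. *)
Lemma der_der_pot z b c i j : 0 < rho a z ->
  der b i (der c j pot) z = - (2 * p%:R *
   (Re (c * (b^J * ddrho a z z j i + 2 * a%:C * ((j == i)%:R * b * (vsqsum z)^J))) * rho a z
    - 2 * Re (c * drho a z z j) * Re (b * drho a z z i)) / rho a z ^+ 2).
Proof.
move=> h0; apply: der_val.
pose r x := rho a (cline z (axis b i) x%:C).
have h k := cderive_cline z (axis b i) k 0.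
have hg := is_derive_Re (cderiveZ c (cderive_drho a h h j)).
have r0 : r 0 != 0 by rewrite /r cline0 gt_eqF.
have hr := @is_deriveV _ r _ _ _ r0 (is_derive_rho z b i).
have h2 := is_derive_eq (is_deriveZ (- (2 * p%:R)) (is_deriveM hg hr)) (erefl _).
apply: near_eq_is_derive (is_derive_eq h2 _).
  near=> x; rewrite der_pot; last by near: x; exact: near_rho_gt0.
  set w := cline z (axis b i) x%:C.
  transitivity (- (2 * p%:R) * (Re (c * drho a w w j) * (rho a w)^-1)); first by [].
  by ring.
have -> : \sum_l ddrho a (cline z (axis b i) 0%:C) (cline z (axis b i) 0%:C) j l *
     (axis b i l)^J = b^J * ddrho a z z j i.
  rewrite cline0 (eq_bigr (fun l => ddrho a z z j l * axis b^J i l)).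
    by rewrite axis_sum mulrC.
  by move=> l _; rewrite /axis rmorphM rmorph_nat.
rewrite /GRing.scale /= /r cline0 {1}/axis.
rewrite [b^J * _ + _]addrC.
have {}r0 : rho a z != 0 by rewrite gt_eqF.
have -> : Re (c * drho a [eta z] [eta z] j) = Re (c * drho a z z j) by [].
by field.
Unshelve. all: by end_near. Qed.

Lemma ddbar_pot z i j : 0 < rho a z ->
  ddbar pot z i j = - p%:R * ((rhoc a z z * ddrho a z z i j
                      - drho a z z i * (drho a z z j)^J) / rhoc a z z ^+ 2).
Proof.
move=> h0.
have ex k (f : cpt m -> R) : dx k f = der 1 k f.
  by apply/funext => w; rewrite /dx /der; congr (derive1 _ 0); apply/funext => x; rewrite shift_re.
have ey k (f : cpt m -> R) : dy k f = der 'i k f.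
  by apply/funext => w; rewrite /dy /der; congr (derive1 _ 0); apply/funext => x; rewrite shift_im.
have dJ : ddrho a z z i j = (ddrho a z z j i)^J.
  rewrite /ddrho !(rmorph_nat, rmorphM, rmorphD, rmorphN) /= oppr0 -/(a%:C) eq_sym.
  by rewrite conjcK; ring.
rewrite /ddbar !ex !ey !der_der_pot // -rhoE dJ.
move: (ddrho a z z j i) (drho a z z i) (drho a z z j) ((vsqsum z)^J) => K A B S.
(* Isolates the pure second derivative as a single unknown [T]; it cancels once real and imaginary
   parts are expanded. *)
have hT c : 2 * a%:C * ((j == i)%:R * c * S) = c * (2 * a%:C * ((j == i)%:R * S)) by ring.
rewrite !hT; move: (2 * a%:C * _) => T.
have r0 : rho a z != 0 by rewrite gt_eqF.
rewrite -(rmorphXn (real_complex R)) /= -(fmorphV (real_complex R)) /=.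
rewrite -[p%:R in RHS](rmorph_nat (real_complex R)) /=.
case: K A B T => k1 k2 [a1 a2] [b1 b2] [t1 t2].
by apply: complexP => /=; field.
Qed.

End Potential.
End PotentialDerivatives.

(** * The isometry condition for a rational map, with denominators cleared *)

Section RationalIsometry.
Context {R : realType}.
Local Notation C := R[i].
Local Notation cpoly n := (mpoly.mpoly n C).
Local Notation cpt := (@cpt R).

Variables (n m : nat) (P : 'I_m -> cpoly n) (Q : cpoly n).
Hypothesis Q_neq0 : forall z, in_ball z -> peval z Q != 0.

Definition ratmap (z : cpt n) : cpt m := fun k => peval z (P k) / peval z Q.

Definition dratmap (z : cpt n) (k : 'I_m) (i : 'I_n) : C :=
  (peval z (mderiv i (P k)) * peval z Q - peval z (P k) * peval z (mderiv i Q))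
  / peval z Q ^+ 2.

Lemma cderive_ratmap (a b : cpt n) t k : in_ball (cline a b t%:C) ->
  cderive (fun x => ratmap (cline a b x%:C) k) t
    (\sum_i b i * dratmap (cline a b t%:C) k i).
Proof.
move=> /Q_neq0 hQ.
apply: cderive_eq (cderive_div hQ (cderive_peval a b (P k) t) (cderive_peval a b Q t)) _.
rewrite mulr_suml mulr_sumr -sumrB mulr_suml; apply: eq_bigr => i _.
by rewrite /dratmap; field.
Qed.

Lemma derive1_val (f g : R -> R) (t d : R) :
  is_derive t (1 : R) g d -> f =1 g -> derive1 f t = d.
Proof. by move=> hg /funext ->; rewrite derive1E derive_val. Qed.

(** The derivative along ['i] is ['i] times the derivative along 1, so the two halves of [dz] add up
    to the formal derivative. [F] agrees with [ratmap] only on the ball, hence the passage through a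
    neighbourhood. *)
Lemma dz_ratmap (F : cpt n -> cpt m) z k j :
  (forall z, in_ball z -> F z = ratmap z) -> in_ball z ->
  dz j (fun w => F w k) z = dratmap z k j.
Proof.
move=> hF hz.
have h c : cderive (fun x => F (cline z (axis c j) x%:C) k) 0 (c * dratmap z k j).
  have hz0 : in_ball (cline z (axis c j) 0%:C) by rewrite cline0.
  apply: near_eq_cderive (cderive_eq (cderive_ratmap k hz0) _).
    by near=> x; rewrite hF //; near: x; exact: near_in_ball.
  rewrite cline0 (eq_bigr (fun i => dratmap z k i * axis c j i)).
    by rewrite axis_sum mulrC.
  by move=> i _; rewrite mulrC.
have ex : dxc j (fun w => F w k) z = dratmap z k j.
  have [h1 h2] := h 1; rewrite mul1r in h1 h2.
  apply: complexP; rewrite /dxc /dx /=.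
    by apply: derive1_val h1 _ => t; rewrite shift_re.
  by apply: derive1_val h2 _ => t; rewrite shift_re.
have ey : dyc j (fun w => F w k) z = 'i * dratmap z k j.
  have [h1 h2] := h 'i.
  apply: complexP; rewrite /dyc /dy.
    by apply: derive1_val h1 _ => t; rewrite shift_im.
  by apply: derive1_val h2 _ => t; rewrite shift_im.
rewrite /dz ex ey mulrA -expr2 sqr_i mulN1r opprK.
by apply: complexP; case: (dratmap z k j) => x y /=; field.
Unshelve. all: by end_near. Qed.

(* Numerator of the mixed second derivative of [log rho]. *)
Definition loghess p (a : R) (u v : cpt p) (k l : 'I_p) : C :=
  rhoc a u v * ddrho a u v k l - drho a u v k * (drho a v u l)^J.

Lemma isometry_identity (F : cpt n -> cpt m) : (0 < m)%N ->
  (forall z, in_ball z -> F z = ratmap z) ->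
  (forall z, in_ball z -> in_DIV (F z)) ->
  holo_isometry F ->
  exists2 kappa : R, 0 < kappa & forall z, in_ball z -> forall i j,
    (\sum_k \sum_l loghess 4^-1 (ratmap z) (ratmap z) k l
       * dratmap z k i * (dratmap z l j)^J) * rhoc 0 z z ^+ 2 =
    kappa%:C * loghess 0 z z i j * rhoc 4^-1 (ratmap z) (ratmap z) ^+ 2.
Proof.
move=> m0 hF hD [lam [lam0 hiso]].
(* The exponents [n.+1] and [m] of the two kernels are absorbed into the isometry constant. *)
exists (lam * n.+1%:R / m%:R); first by rewrite divr_gt0 ?mulr_gt0 ?ltr0n.
move=> z hz i j; have := hiso z hz i j.
have rz : 0 < rho 0 z by rewrite /rho mul0r addr0 subr_gt0.
have eb : (fun w => ln (bergman_ball w)) = (fun w : cpt n => ln (rho 0 w ^- n.+1)).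
  by apply/funext => w; rewrite /bergman_ball /rho mul0r addr0.
have := hD z hz; rewrite hF // => -[_ rF'].
have rF : 0 < rho 4^-1 (ratmap z) := rF'.
rewrite /omega_ball eb ddbar_pot // /pullback hF //.
under eq_bigr do under eq_bigr do
  rewrite (dz_ratmap _ _ hF) // (dz_ratmap _ _ hF) // /omega_DIV ddbar_pot //.
have r1 : rhoc 4^-1 (ratmap z) (ratmap z) != 0.
  by rewrite -rhoE; apply/eqP => /complexI => e; move: rF; rewrite e ltxx.
have r0 : rhoc 0 z z != 0.
  by rewrite -rhoE; apply/eqP => /complexI => e; move: rz; rewrite e ltxx.
have m1 : m%:R != 0 :> C by rewrite pnatr_eq0 -lt0n.
have -> : \sum_k \sum_l - m%:R * ((rhoc 4^-1 (ratmap z) (ratmap z) *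
      ddrho 4^-1 (ratmap z) (ratmap z) k l -
      drho 4^-1 (ratmap z) (ratmap z) k * (drho 4^-1 (ratmap z) (ratmap z) l)^J) /
      rhoc 4^-1 (ratmap z) (ratmap z) ^+ 2) * dratmap z k i * (dratmap z l j)^J
    = - m%:R / rhoc 4^-1 (ratmap z) (ratmap z) ^+ 2 *
      \sum_k \sum_l loghess 4^-1 (ratmap z) (ratmap z) k l
       * dratmap z k i * (dratmap z l j)^J.
  rewrite mulr_sumr; apply: eq_bigr => k _; rewrite mulr_sumr; apply: eq_bigr => l _.
  by rewrite /loghess; field.
rewrite -/(loghess 0 z z i j) => h.
have c0 : - m%:R / rhoc 4^-1 (ratmap z) (ratmap z) ^+ 2 != 0.
  by rewrite mulf_neq0 ?oppr_eq0 // invr_neq0 // expf_neq0.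
rewrite -(mulKf c0 (\sum_k _)) h -/(lam%:C).
rewrite !(rmorph_nat, rmorphM, fmorphV) /=.
by field; rewrite r0 r1 m1.
Qed.

End RationalIsometry.

(** * Sesquirationality of the potentials pulled back by a map *)

Section SesquirationalPotentials.
Context {R : realType}.
Local Notation C := R[i].
Local Notation cpt := (@cpt R).
Variables (n p : nat) (G : cpt n -> cpt p).
Hypothesis hG : forall k, sesquirational (fun z _ => G z k).

Let hGJ k : sesquirational (fun z w : cpt n => (G w k)^J).
Proof. exact: (sesquirationalJ (hG k)). Qed.

Lemma sesquirational_vsqsum : sesquirational (fun z _ => vsqsum (G z)).
Proof. by apply: sesquirational_sum => k; exact: sesquirationalX. Qed.

Let hSJ : sesquirational (fun z w : cpt n => (vsqsum (G w))^J).
Proof. exact: (sesquirationalJ sesquirational_vsqsum). Qed.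

Lemma sesquirational_rhoc a : sesquirational (fun z w => rhoc a (G z) (G w)).
Proof.
apply: sesquirationalD; last first.
  apply: sesquirationalM (sesquirational_cst _) _.
  by apply: sesquirationalM => //; exact: sesquirational_vsqsum.
apply: sesquirationalB (sesquirational_cst _) _.
by apply: sesquirational_sum => k; exact: sesquirationalM.
Qed.

Lemma sesquirational_drho a k : sesquirational (fun z w => drho a (G z) (G w) k).
Proof.
apply: sesquirationalD; first exact: sesquirationalN.
apply: sesquirationalM (sesquirational_cst _) _; exact: sesquirationalM.
Qed.

Lemma sesquirational_loghess a k l :
  sesquirational (fun z w => loghess a (G z) (G w) k l).
Proof.
apply: sesquirationalB; apply: sesquirationalM.
- exact: sesquirational_rhoc.
- apply: sesquirationalD (sesquirational_cst _) _.
  apply: sesquirationalM (sesquirational_cst _) _; exact: sesquirationalM.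
- exact: sesquirational_drho.
- exact: (sesquirationalJ (sesquirational_drho a l)).
Qed.

End SesquirationalPotentials.

(** * The polarized isometry identity and the linear part of the map *)

Section PolarizedIsometry.
Context {R : realType}.
Local Notation C := R[i].
Local Notation cpoly n := (mpoly.mpoly n C).
Local Notation cpt := (@cpt R).

Variables (n m : nat) (P : 'I_m -> cpoly n) (Q : cpoly n).
Hypothesis Q_neq0 : forall z, in_ball z -> peval z Q != 0.
Local Notation f := (ratmap P Q).
Local Notation df := (dratmap P Q).
Local Notation a4 := (4^-1 : R).
Variable kappa : R.
Hypothesis iso : forall z, in_ball z -> forall i j,
    (\sum_k \sum_l loghess a4 (f z) (f z) k l * df z k i * (df z l j)^J)
      * rhoc 0 z z ^+ 2 =
    kappa%:C * loghess 0 z z i j * rhoc a4 (f z) (f z) ^+ 2.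
Hypothesis f0 : f (fun=> 0) = fun=> 0.

Let o : cpt n := fun=> 0.

Lemma sesquirational_ratmap k : sesquirational (fun z _ => f z k).
Proof.
apply: sesquirationalM; first exact: sesquirational_peval.
by apply: sesquirationalV => [|z w hz _]; [exact: sesquirational_peval | exact: Q_neq0].
Qed.

Lemma sesquirational_dratmap k i : sesquirational (fun z _ => df z k i).
Proof.
apply: sesquirationalM; last first.
  apply: sesquirationalV => [|z w hz _]; last by rewrite expf_neq0 // Q_neq0.
  by apply: sesquirationalX; exact: sesquirational_peval.
by apply: sesquirationalB; apply: sesquirationalM; exact: sesquirational_peval.
Qed.

(** The difference of the two sides is sesquirational and vanishes on the diagonal. *)
Lemma iso_polarized z w : in_ball z -> in_ball w -> forall i j,
  (\sum_k \sum_l loghess a4 (f z) (f w) k l * df z k i * (df w l j)^J)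
      * rhoc 0 z w ^+ 2 =
    kappa%:C * loghess 0 z w i j * rhoc a4 (f z) (f w) ^+ 2.
Proof.
move=> hz hw i j; apply/eqP; rewrite -subr_eq0; apply/eqP.
pose E z w := (\sum_k \sum_l loghess a4 (f z) (f w) k l * df z k i * (df w l j)^J)
      * rhoc 0 z w ^+ 2 - kappa%:C * loghess 0 z w i j * rhoc a4 (f z) (f w) ^+ 2.
apply: (@polarization _ _ E) => // [|u hu]; last by rewrite /E iso ?subrr.
have hid k : sesquirational (fun z _ : cpt n => z k) := @sesquirational_coord R n k.
apply: sesquirationalB; apply: sesquirationalM.
- apply: sesquirational_sum => k; apply: sesquirational_sum => l.
  apply: sesquirationalM; last exact: (sesquirationalJ (sesquirational_dratmap l j)).
  apply: sesquirationalM; last exact: sesquirational_dratmap.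
  exact: (sesquirational_loghess sesquirational_ratmap).
- by apply: sesquirationalX; exact: (sesquirational_rhoc hid).
- apply: sesquirationalM (sesquirational_cst _) _.
  exact: (sesquirational_loghess hid).
- by apply: sesquirationalX; exact: (sesquirational_rhoc sesquirational_ratmap).
Qed.

Definition dirder (z v : cpt n) : cpt m := fun k => \sum_i v i * df z k i.

Lemma cderive_f (a b : cpt n) t k : in_ball (cline a b t%:C) ->
  cderive (fun x => f (cline a b x%:C) k) t (dirder (cline a b t%:C) b k).
Proof. exact: cderive_ratmap. Qed.

(** Contraction with a holomorphic direction [v] and an antiholomorphic direction [u] puts the
    identity in the form of a quotient-rule numerator, ready to be integrated along lines. *)
Lemma iso_contracted z w v u : in_ball z -> in_ball w ->
  (rhoc a4 (f z) (f w)
     * (\sum_k (\sum_l ddrho a4 (f z) (f w) k l * (dirder w u l)^J) * dirder z v k)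
   - (\sum_k drho a4 (f z) (f w) k * dirder z v k)
     * (\sum_l (drho a4 (f w) (f z) l * dirder w u l)^J)) * (1 - hdot z w) ^+ 2 =
  - kappa%:C * ((1 - hdot z w) * hdot v u + hdot v w * hdot z u)
    * rhoc a4 (f z) (f w) ^+ 2.
Proof.
move=> hz hw.
have r0 : rhoc 0 z w = 1 - hdot z w by rewrite /rhoc mul0r addr0.
have -> : rhoc a4 (f z) (f w)
     * (\sum_k (\sum_l ddrho a4 (f z) (f w) k l * (dirder w u l)^J) * dirder z v k)
   - (\sum_k drho a4 (f z) (f w) k * dirder z v k)
     * (\sum_l (drho a4 (f w) (f z) l * dirder w u l)^J) =
   \sum_k \sum_l loghess a4 (f z) (f w) k l * dirder z v k * (dirder w u l)^J.
  rewrite [X in _ - X]big_distrlr mulr_sumr -sumrB; apply: eq_bigr => k _.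
  rewrite mulr_suml mulr_sumr -sumrB; apply: eq_bigr => l _.
  by rewrite /loghess rmorphM /=; ring.
have -> : \sum_k \sum_l loghess a4 (f z) (f w) k l * dirder z v k * (dirder w u l)^J =
  \sum_i \sum_j v i * (u j)^J *
    \sum_k \sum_l loghess a4 (f z) (f w) k l * df z k i * (df w l j)^J.
  transitivity (\sum_k \sum_l \sum_i \sum_j v i * (u j)^J *
     (loghess a4 (f z) (f w) k l * df z k i * (df w l j)^J)).
    apply: eq_bigr => k _; apply: eq_bigr => l _.
    rewrite /dirder rmorph_sum [loghess _ _ _ _ _ * _]mulr_sumr mulr_suml; apply: eq_bigr => i _.
    by rewrite mulr_sumr; apply: eq_bigr => j _; rewrite rmorphM /=; ring.
  under eq_bigr do rewrite exchange_big /=.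
  rewrite exchange_big /=; apply: eq_bigr => i _.
  under eq_bigr do rewrite exchange_big /=.
  rewrite exchange_big /=; apply: eq_bigr => j _.
  rewrite mulr_sumr; apply: eq_bigr => k _; rewrite mulr_sumr.
  by [].
transitivity (\sum_i \sum_j v i * (u j)^J *
   (kappa%:C * loghess 0 z w i j * rhoc a4 (f z) (f w) ^+ 2)).
  rewrite mulr_suml; apply: eq_bigr => i _.
  rewrite mulr_suml; apply: eq_bigr => j _.
  by rewrite -iso_polarized // r0 mulrA.
rewrite [hdot v u]/hdot [hdot v w]/hdot.
rewrite mulr_sumr mulr_suml -big_split /= mulr_sumr mulr_suml; apply: eq_bigr => i _.
rewrite (eq_bigr (fun j => - kappa%:C * rhoc a4 (f z) (f w) ^+ 2 * ((1 - hdot z w) * (i == j)%:R * (v i * (u j)^J))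
   + - kappa%:C * rhoc a4 (f z) (f w) ^+ 2 * (v i * (w i)^J * (z j * (u j)^J)))); last first.
  move=> j _; rewrite /loghess r0 /ddrho /drho !mulr0 !mul0r !addr0 rmorphN /= conjcK.
  by ring.
rewrite big_split /= -!mulr_sumr -/(hdot z u) (bigD1 i) //= eqxx big1; last first.
  by move=> j ji; rewrite eq_sym (negbTE ji) mulr0 mul0r.
by rewrite (_ : true%:R = 1 :> C) //; ring.
Qed.

(** The polarized identity at [w = 0]: since [f] fixes the origin, both potentials equal 1 there and
    their derivatives in [z] vanish. *)
Lemma jacobian_orthogonal u i j : in_ball u ->
  \sum_k df u k i * (df o k j)^J = kappa%:C * (i == j)%:R.
Proof.
have ho : in_ball o := @in_ball0 R n.
move=> hu; have := iso_polarized hu ho i j.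
have s0 p : vsqsum ((fun=> 0) : cpt p) = 0.
  by rewrite /vsqsum big1 // => k _; rewrite expr0n.
have h0 p (x : cpt p) : hdot x ((fun=> 0) : cpt p) = 0.
  by rewrite /hdot big1 // => k _; rewrite rmorph0 mulr0.
have r1 p a (x : cpt p) : rhoc a x ((fun=> 0) : cpt p) = 1.
  by rewrite /rhoc h0 s0 rmorph0 !mulr0 subr0 addr0.
have l1 p a (x : cpt p) k l : loghess a x ((fun=> 0) : cpt p) k l = - (k == l)%:R.
  rewrite /loghess r1 /ddrho /drho s0 rmorph0 !mulr0 !addr0 oppr0 mul0r subr0.
  by rewrite mul1r.
rewrite f0 !r1 l1 expr1n !mulr1.
have -> : \sum_k \sum_l loghess a4 (f u) ((fun=> 0) : cpt m) k l * df u k i * (df o l j)^J =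
  - \sum_k df u k i * (df o k j)^J.
  rewrite -sumrN; apply: eq_bigr => k _; rewrite (bigD1 k) //= big1.
    by rewrite l1 eqxx (_ : true%:R = 1 :> C) // addr0; ring.
  by move=> l lk; rewrite l1 eq_sym (negbTE lk) oppr0 !mul0r.
by move=> /eqP; rewrite mulrN eqr_opp => /eqP.
Qed.

(** Integration of [jacobian_orthogonal] along the segment from 0 to [z]. *)
Lemma linear_part z j : in_ball z -> \sum_k f z k * (df o k j)^J = kappa%:C * z j.
Proof.
move=> hz; pose g (t : R) := \sum_k f (cline o z t%:C) k * (df o k j)^J - t%:C * (kappa%:C * z j).
have hb t : 0 <= t <= 1 -> in_ball (cline o z t%:C).
  move=> ht; have -> : cline o z t%:C = fun k => t%:C * z k.
    by apply/funext => k; rewrite /cline add0r.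
  exact: in_ball_scale.
have : g 0 = g 1.
  apply: cderive0_cst => // t /hb ht.
  have h1 := cderive_sum (index_enum 'I_m)
     (fun k => cderiveM (cderive_f k ht) (cderive_cst (df o k j)^J t)).
  have h2 := cderiveM (cderive_id t) (cderive_cst (kappa%:C * z j) t).
  apply: cderive_eq (cderiveB h1 h2) _.
  rewrite mulr0 addr0 mul1r (eq_bigr (fun k => \sum_i z i * (df (cline o z t%:C) k i * (df o k j)^J))).
    rewrite exchange_big /= (eq_bigr (fun i => z i * (kappa%:C * (i == j)%:R))).
      rewrite (bigD1 j) //= eqxx big1 => [|i ij]; last by rewrite (negbTE ij) !mulr0.
      by rewrite (_ : true%:R = 1 :> C) //; ring.
    by move=> i _; rewrite -mulr_sumr jacobian_orthogonal.
  by move=> k _; rewrite mulr0 addr0 mulr_suml; apply: eq_bigr => i _; rewrite mulrA.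
rewrite /g cline0 f0 (_ : cline o z 1%:C = z); last first.
  by apply/funext => k; rewrite /cline add0r mul1r.
rewrite big1 => [|k _]; last by rewrite mul0r.
by rewrite mul0r subr0 mul1r => /esym/eqP; rewrite subr_eq0 => /eqP.
Qed.

End PolarizedIsometry.

(** * Integration of the polarized identity, first in [w], then in [z] *)

Section FunctionalEquation.
Context {R : realType}.
Local Notation C := R[i].
Local Notation cpoly n := (mpoly.mpoly n C).
Local Notation cpt := (@cpt R).

Variables (n m : nat) (P : 'I_m -> cpoly n) (Q : cpoly n).
Hypothesis Q_neq0 : forall z, in_ball z -> peval z Q != 0.
Local Notation f := (ratmap P Q).
Local Notation df := (dratmap P Q).
Local Notation dirder := (dirder P Q).
Local Notation a4 := (4^-1 : R).
Variable kappa : R.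
Hypothesis iso : forall z, in_ball z -> forall i j,
    (\sum_k \sum_l loghess a4 (f z) (f z) k l * df z k i * (df z l j)^J)
      * rhoc 0 z z ^+ 2 =
    kappa%:C * loghess 0 z z i j * rhoc a4 (f z) (f z) ^+ 2.
Hypothesis f0 : f (fun=> 0) = fun=> 0.

Let o : cpt n := fun=> 0.
Let g z w : C := rhoc a4 (f z) (f w).
Let g1 z w v : C := \sum_k drho a4 (f z) (f w) k * dirder z v k.

Lemma hdot_scale (z w : cpt n) (t : R) : hdot z (cline o w t%:C) = t%:C * hdot z w.
Proof.
rewrite /hdot mulr_sumr; apply: eq_bigr => k _.
by rewrite /cline add0r rmorphM /= oppr0 -/(t%:C); ring.
Qed.

Lemma rhoc_f_0 z : g z o = 1.
Proof.
rewrite /g f0 /rhoc /hdot /vsqsum big1 => [|k _]; last by rewrite rmorph0 mulr0.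
by rewrite [\sum_j 0 ^+ 2]big1 ?rmorph0 ?mulr0 ?subr0 ?addr0 // => k _; rewrite expr0n.
Qed.

Lemma drho_f_0 z v : g1 z o v = 0.
Proof.
rewrite /g1 f0 big1 // => k _; rewrite /drho /vsqsum [\sum_j 0 ^+ 2]big1.
  by rewrite rmorph0 !mulr0 oppr0 addr0 mul0r.
by move=> j _; rewrite expr0n.
Qed.

(** First integration, along [t w]. Dividing by [g] requires it to be nonzero, which is known only
    near [t = 0], where [g = 1]. *)
Lemma log_derivative_near z w v : in_ball z -> in_ball w ->
  \forall t \near (0 : R), (1 - hdot z (cline o w t%:C)) * g1 z (cline o w t%:C) v
    + kappa%:C * hdot v (cline o w t%:C) * g z (cline o w t%:C) = 0.
Proof.
move=> hz hw; pose u t := cline o w t%:C.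
have ub : \forall t \near (0 : R), in_ball (u t).
  by apply: near_in_ball; rewrite cline0; exact: in_ball0.
have dfz t k : cderive (fun _ : R => f z k) t 0 := cderive_cst (f z k) t.
have dg t : in_ball (u t) -> cderive (fun x => g z (u x)) t
    (\sum_l (drho a4 (f (u t)) (f z) l * dirder (u t) w l)^J).
  move=> hu; have hf k := cderive_f P Q_neq0 k hu.
  apply: cderive_eq (@cderive_rhoc _ _ a4 _ _ _ _ t (dfz t) hf) _.
  by rewrite big1 ?add0r // => k _; rewrite mulr0.
have dg1 t : in_ball (u t) -> cderive (fun x => g1 z (u x) v) t
    (\sum_k (\sum_l ddrho a4 (f z) (f (u t)) k l * (dirder (u t) w l)^J) * dirder z v k).
  move=> hu; have hf k := cderive_f P Q_neq0 k hu.
  apply: cderive_sum => k.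
  apply: cderive_eq (cderiveM (@cderive_drho _ _ a4 _ _ _ _ t (dfz t) hf k)
     (cderive_cst (dirder z v k) t)) _.
  by rewrite mul0r !mulr0 add0r addr0.
have gn : \forall t \near (0 : R), g z (u t) != 0.
  apply: (cderive_near_neq0 (dg 0 _)); rewrite /u cline0; last first.
    by rewrite rhoc_f_0 oner_eq0.
  exact: in_ball0.
have : \forall t \near (0 : R), in_ball (u t) /\ g z (u t) != 0.
  by near=> t; split; near: t.
move=> /nbhs_ballP [e /= e0 he].
have hh t : `|t| < e -> in_ball (u t) /\ g z (u t) != 0.
  by move=> te; apply: he; rewrite /ball /= sub0r normrN.
(* The derivative in [z] along [v] of [log g - kappa log (1 - <z, t w>)]; it vanishes at [t = 0]. *)
pose W t := g1 z (u t) v / g z (u t) + t%:C * (kappa%:C * hdot v w) / (1 - t%:C * hdot z w).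
have dW t : `|t| < e -> cderive W t 0.
  move=> /hh [bt gt]; have r0 : 1 - t%:C * hdot z w != 0.
    by rewrite -hdot_scale; exact: hdot_neq1.
  have h1 := cderive_div gt (dg1 t bt) (dg t bt).
  have h2 := cderiveM (cderive_id t) (cderive_cst (kappa%:C * hdot v w) t).
  have h3 := cderiveB (cderive_cst 1 t) (cderiveM (cderive_id t) (cderive_cst (hdot z w) t)).
  apply: cderive_eq (cderiveD h1 (cderive_div r0 h2 h3)) _.
  have := iso_contracted Q_neq0 iso v w hz bt; rewrite !hdot_scale -/(g _ _).
  rewrite -/(g1 z (u t) v).
  set B' := \sum_k (\sum_l ddrho a4 (f z) (f (u t)) k l * (dirder (u t) w l)^J) * dirder z v k.
  set G' := \sum_l (drho a4 (f (u t)) (f z) l * dirder (u t) w l)^J.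
  move: gt r0; set G := g z (u t); set r := 1 - t%:C * hdot z w => gt r0 h.
  have -> : (B' * G - g1 z (u t) v * G') = - kappa%:C * (r * hdot v w + t%:C * hdot v w * hdot z w) * G ^+ 2 / r ^+ 2.
    by rewrite -h; field.
  by rewrite /r; field; rewrite gt r0.
near=> t; have te : `|t| < e.
  near: t; apply/nbhs_ballP; exists e => //= x; by rewrite /ball /= sub0r normrN.
have [bt gt] := hh t te.
have r0 : 1 - t%:C * hdot z w != 0 by rewrite -hdot_scale; exact: hdot_neq1.
have W0 : W t = 0.
  have W00 : W 0 = 0 by rewrite /W /u cline0 drho_f_0 !mul0r addr0.
  rewrite -W00; have [t0|t0] := leP 0 t.
    apply/esym/cderive0_cst => // x /andP[x0 xt]; apply: dW.
    by rewrite ger0_norm //; apply: le_lt_trans xt _; rewrite (le_lt_trans _ te) ?ler_norm.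
  apply: cderive0_cst => [|x /andP[tx x0]]; first exact: ltW.
  apply: dW; rewrite ler0_norm //; apply: le_lt_trans te.
  by rewrite ler0_norm ?lerN2 // ltW.
rewrite !hdot_scale -/(u t).
have -> : (1 - t%:C * hdot z w) * g1 z (u t) v + kappa%:C * (t%:C * hdot v w) * g z (u t)
   = W t * ((1 - t%:C * hdot z w) * g z (u t)).
  by rewrite /W; field; rewrite gt r0.
by rewrite W0 mul0r.
Unshelve. all: by end_near. Qed.

(** Both sides are sesquirational, so the identity for small [t] extends to [t = 1] along the line
    that fixes [z] and scales [w]. *)
Lemma log_derivative z w v : in_ball z -> in_ball w ->
  (1 - hdot z w) * g1 z w v + kappa%:C * hdot v w * g z w = 0.
Proof.
move=> hz hw.
pose E z w := (1 - hdot z w) * g1 z w v + kappa%:C * hdot v w * g z w.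
have hf := sesquirational_ratmap P Q_neq0.
have hid k : sesquirational (fun z _ : cpt n => z k) := @sesquirational_coord R n k.
have hE : sesquirational E.
  apply: sesquirationalD; apply: sesquirationalM.
  - apply: sesquirationalB (sesquirational_cst _) _.
    apply: sesquirational_sum => k; apply: sesquirationalM => //.
    exact: (sesquirationalJ (hid k)).
  - apply: sesquirational_sum => k; apply: sesquirationalM.
      exact: (sesquirational_drho hf).
    apply: sesquirational_sum => i; apply: sesquirationalM (sesquirational_cst _) _.
    exact: sesquirational_dratmap.
  - apply: sesquirationalM (sesquirational_cst _) _.
    apply: sesquirational_sum => k; apply: sesquirationalM (sesquirational_cst _) _.
    exact: (sesquirationalJ (hid k)).
  - exact: (sesquirational_rhoc hf).
have e1 : cline z o 1 = z by apply/funext => k; rewrite /cline mulr0 addr0.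
have e2 : cline o w 1^J = w by apply/funext => k; rewrite /cline rmorph1 add0r mul1r.
have := @sesquirational_near_eq0 R n E z o o w 1 hE.
rewrite e1 e2; apply=> //; last exact: in_ball0.
near=> t; have -> : cline z o t%:C = z by apply/funext => k; rewrite /cline mulr0 addr0.
by near: t; exact: log_derivative_near.
Unshelve. all: by end_near. Qed.

(** Second integration, along [t z]. Here [mu] plays the role of [(1 - t <z, w>)^kappa] and is left
    abstract to avoid complex powers: it solves the same linear equation as [g (t z) w], so their
    quotient is constant. *)
Lemma rhoc_f_comparison (mu mu' : R -> C) z w : in_ball z -> in_ball w ->
  (forall t, 0 <= t <= 1 -> cderive mu t (mu' t)) ->
  (forall t, 0 <= t <= 1 -> mu t != 0) ->
  (forall t, 0 <= t <= 1 ->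
     (1 - t%:C * hdot z w) * mu' t + kappa%:C * hdot z w * mu t = 0) ->
  mu 0 = 1 -> rhoc a4 (f z) (f w) = mu 1.
Proof.
move=> hz hw dmu mu0 hmu mu1.
pose u t := cline o z t%:C.
have hb t : 0 <= t <= 1 -> in_ball (u t).
  move=> ht; have -> : u t = fun k => t%:C * z k.
    by apply/funext => k; rewrite /u /cline add0r.
  exact: in_ball_scale.
have hd t : hdot (u t) w = t%:C * hdot z w.
  by rewrite /hdot mulr_sumr; apply: eq_bigr => k _; rewrite /u /cline add0r mulrA.
have dg t : 0 <= t <= 1 -> cderive (fun x => g (u x) w) t (g1 (u t) w z).
  move=> ht; have hf k := cderive_f P Q_neq0 k (hb t ht).
  have dfw k : cderive (fun _ : R => f w k) t 0 := cderive_cst (f w k) t.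
  apply: cderive_eq (@cderive_rhoc _ _ a4 _ _ _ _ t hf dfw) _.
  by rewrite [X in _ + X]big1 ?addr0 // => k _; rewrite mulr0 rmorph0.
have : g (u 0) w / mu 0 = g (u 1) w / mu 1.
  apply: (@cderive0_cst _ (fun t => g (u t) w / mu t)) => // t ht.
  apply: cderive_eq (cderive_div (mu0 t ht) (dg t ht) (dmu t ht)) _.
  have := log_derivative z (hb t ht) hw; rewrite hd.
  have r0 : 1 - t%:C * hdot z w != 0 by rewrite -hd; exact: hdot_neq1 (hb t ht) hw.
  have := hmu t ht; move: r0; set r := 1 - _ => r0 e1 e2.
  have -> : mu' t = - kappa%:C * hdot z w * mu t / r.
    by apply: (mulfI r0); rewrite mulrCA mulfV // mulr1; apply/eqP; rewrite -subr_eq0 !mulNr opprK e1.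
  have -> : g1 (u t) w z = - kappa%:C * hdot z w * g (u t) w / r.
    by apply: (mulfI r0); rewrite mulrCA mulfV // mulr1; apply/eqP; rewrite -subr_eq0 !mulNr opprK e2.
  by field; rewrite r0 mu0.
have e1 : u 1 = z by apply/funext => k; rewrite /u /cline add0r mul1r.
have e0 : g (u 0) w = 1.
  rewrite /u cline0 /g f0 /rhoc /hdot /vsqsum big1 => [|k _]; last by rewrite mul0r.
  by rewrite [\sum_j 0 ^+ 2]big1 ?mul0r ?mulr0 ?subr0 ?addr0 // => k _; rewrite expr0n.
rewrite e1 e0 mu1 divr1 -/(g z w) => h; have m0 : mu 1 != 0 by rewrite mu0 // ler01 lexx.
by rewrite -[g z w](mulfVK m0) -h mul1r.
Qed.

End FunctionalEquation.

(** * Hermitian products, linear dependence and a convexity inequality *)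

Section LinearAlgebra.
Context {R : realType}.
Local Notation C := R[i].
Local Notation cpt := (@cpt R).

(** The two families together give [2 n] vectors in dimension [m]; a nonzero row in the kernel of
    the stacked matrix supplies the coefficients. *)
Lemma linear_dependence n m (a b : 'I_n -> cpt m) : (m < 2 * n)%N ->
  exists x y : cpt n, (exists i, (x i != 0) || (y i != 0)) /\
    forall k, \sum_i x i * a i k + \sum_i y i * b i k = 0.
Proof.
move=> mn.
pose M : 'M[C]_(n + n, m) := col_mx (\matrix_(i, k) a i k) (\matrix_(i, k) b i k).
have : kermx M != 0.
  rewrite -mxrank_eq0 mxrank_ker subn_eq0 -ltnNge.
  by apply: leq_ltn_trans (rank_leq_col M) _; rewrite addnn -mul2n.
move=> /rowV0Pn [v /sub_kermxP vM v0].
exists (fun i => v 0 (lshift n i)), (fun i => v 0 (rshift n i)); split.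
  apply/existsP; apply: contraNT v0; rewrite negb_exists => /forallP h.
  apply/eqP/rowP => i; rewrite mxE; case: (split_ordP i) => j ->; move: (h j);
  by rewrite negb_or !negbK => /andP[/eqP h1 /eqP h2].
move=> k; have /rowP /(_ k) := vM; rewrite !mxE big_split_ord /= => e.
rewrite -[RHS]e; congr (_ + _); apply: eq_bigr => i _.
- by rewrite col_mxEu mxE.
- by rewrite col_mxEd mxE.
Qed.

Lemma hdotC m (u v : cpt m) : hdot u v = (hdot v u)^J.
Proof.
by rewrite /hdot rmorph_sum; apply: eq_bigr => k _; rewrite rmorphM /= conjcK mulrC.
Qed.

Lemma hdotBl m (u u' v : cpt m) : hdot (fun k => u k - u' k) v = hdot u v - hdot u' v.
Proof. by rewrite /hdot -sumrB; apply: eq_bigr => k _; rewrite mulrBl. Qed.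

Lemma hdotBr m (u v v' : cpt m) : hdot u (fun k => v k - v' k) = hdot u v - hdot u v'.
Proof. by rewrite /hdot -sumrB; apply: eq_bigr => k _; rewrite rmorphB mulrBr. Qed.

Lemma hdot_suml (I : finType) m (x : I -> C) (u : I -> cpt m) v :
  hdot (fun k => \sum_i x i * u i k) v = \sum_i x i * hdot (u i) v.
Proof.
rewrite /hdot; under eq_bigr do rewrite mulr_suml.
rewrite exchange_big; apply: eq_bigr => i _; rewrite mulr_sumr.
by apply: eq_bigr => k _; rewrite mulrA.
Qed.

Lemma hdot_sumr (I : finType) m (x : I -> C) u (v : I -> cpt m) :
  hdot u (fun k => \sum_i x i * v i k) = \sum_i (x i)^J * hdot u (v i).
Proof.
rewrite hdotC hdot_suml rmorph_sum; apply: eq_bigr => i _.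
by rewrite rmorphM /= -hdotC.
Qed.

Lemma hdot_vnormsq m (u : cpt m) : hdot u u = (vnormsq u)%:C.
Proof. by rewrite vnormsqE. Qed.

Lemma vnormsq_eq0 m (u : cpt m) : vnormsq u = 0 -> forall k, u k = 0.
Proof.
move=> /eqP; rewrite psumr_eq0 => [/allP h k|k _]; last exact: csq_ge0.
by apply/eqP; rewrite -csq_eq0; apply: h; rewrite mem_index_enum.
Qed.

(** The tangent line at [p = k y] lies strictly below the exponential at [y] and at 0; with weights
    [k] and [1 - k] the first-order terms cancel. *)
Lemma expR_strictly_convex (k y : R) : 0 < k < 1 -> y != 0 ->
  expR (k * y) < k * expR y + (1 - k).
Proof.
move=> /andP[k0 k1] y0; set p := k * y.
have p0 : - p != 0 by rewrite oppr_eq0 /p mulf_neq0 // gt_eqF.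
have yp : y - p != 0.
  by rewrite /p -[X in X - _]mul1r -mulrBl mulf_neq0 // subr_eq0 gt_eqF.
have h1 : expR y = expR p * expR (y - p) by rewrite -expRD addrC subrK.
have h2 : 1 = expR p * expR (- p) by rewrite -expRD subrr expR0.
have g1 := expR_gt1Dx yp; have g2 := expR_gt1Dx p0; have e0 := expR_gt0 p.
have E1 : expR p * (1 + (y - p)) < expR y by rewrite h1 ltr_pM2l.
have E2 : expR p * (1 + - p) < 1 by rewrite {2}h2 ltr_pM2l.
have E3 : expR p = k * (expR p * (1 + (y - p))) + (1 - k) * (expR p * (1 + - p)).
  by rewrite /p; ring.
rewrite E3 -[X in _ < _ + X]mulr1.
by apply: ltrD; rewrite ltr_pM2l ?subr_gt0.
Qed.

End LinearAlgebra.

(** * The isometry constant equals 1 *)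

Section IsometryConstant.
Context {R : realType}.
Local Notation C := R[i].
Local Notation cpoly n := (mpoly.mpoly n C).
Local Notation cpt := (@cpt R).

Variables (n m : nat) (P : 'I_m -> cpoly n) (Q : cpoly n).
Hypothesis Q_neq0 : forall z, in_ball z -> peval z Q != 0.
Local Notation f := (ratmap P Q).
Local Notation df := (dratmap P Q).
Local Notation a4 := (4^-1 : R).
Variable kappa : R.
Hypothesis iso : forall z, in_ball z -> forall i j,
    (\sum_k \sum_l loghess a4 (f z) (f z) k l * df z k i * (df z l j)^J)
      * rhoc 0 z z ^+ 2 =
    kappa%:C * loghess 0 z z i j * rhoc a4 (f z) (f z) ^+ 2.
Hypothesis f0 : f (fun=> 0) = fun=> 0.
Hypothesis kappa_gt0 : 0 < kappa.

Definition jac0 (j : 'I_n) : cpt m := fun k => df (fun=> 0) k j.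
Definition normal (z : cpt n) : cpt m := fun k => f z k - \sum_j z j * jac0 j k.
(** The factor one half turns the quartic term of [rhoc a4] into the product of [hquad] with its
    conjugate. *)
Definition hquad (z : cpt n) : C := 2^-1 * vsqsum (f z).

Lemma hdot_jac0 i j : hdot (jac0 i) (jac0 j) = kappa%:C * (i == j)%:R.
Proof. by apply: (jacobian_orthogonal Q_neq0 iso f0); exact: in_ball0. Qed.

Lemma hdot_f_jac0 z j : in_ball z -> hdot (f z) (jac0 j) = kappa%:C * z j.
Proof. exact: (linear_part Q_neq0 iso f0). Qed.

Lemma sum_delta (x : 'I_n -> C) (c : C) j : \sum_i x i * (c * (i == j)%:R) = c * x j.
Proof.
rewrite (bigD1 j) //= eqxx big1 => [|i ij]; last by rewrite (negbTE ij) !mulr0.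
by rewrite (_ : true%:R = 1 :> C) //; ring.
Qed.

(** Both [f z] and its linear part have product [kappa z_j] with the column [jac0 j]. *)
Lemma hdot_normal_jac0 z j : in_ball z -> hdot (normal z) (jac0 j) = 0.
Proof.
move=> hz; rewrite hdotBl hdot_f_jac0 // hdot_suml.
under eq_bigr do rewrite hdot_jac0.
by rewrite sum_delta subrr.
Qed.

Lemma hdot_normal z w : in_ball z -> in_ball w ->
  hdot (normal z) (normal w) = hdot (f z) (f w) - kappa%:C * hdot z w.
Proof.
move=> hz hw; rewrite hdotBr hdot_sumr [X in _ - X]big1 => [|j _]; last first.
  by rewrite hdot_normal_jac0 ?mulr0.
rewrite subr0 hdotBl hdot_suml; congr (_ - _); rewrite [hdot z w]/hdot mulr_sumr.
apply: eq_bigr => j _.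
by rewrite hdotC hdot_f_jac0 // rmorphM /= oppr0 -/(kappa%:C); ring.
Qed.

Lemma conj_halfM (x : C) : (2^-1 * x)^J = 2^-1 * x^J.
Proof. by rewrite rmorphM fmorphV rmorph_nat. Qed.

Lemma rhoc_hquad z w :
  rhoc a4 (f z) (f w) = 1 - hdot (f z) (f w) + hquad z * (hquad w)^J.
Proof.
rewrite /rhoc /hquad conj_halfM.
rewrite (_ : a4%:C = 2^-1 * 2^-1); first by ring.
by rewrite fmorphV rmorph_nat; field.
Qed.

(** The points [e_i / 2], whose mutual products 1/4 and 0 are real, so that only real powers occur
    in the comparison. *)
Let pt (i : 'I_n) : cpt n := axis (2^-1) i.

Lemma hdot_pt i j : hdot (pt i) (pt j) = 4^-1 * (i == j)%:R.
Proof.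
rewrite /hdot (eq_bigr (fun k => pt i k * axis 2^-1 j k)).
  by rewrite axis_sum /pt /axis eq_sym; field.
by move=> k _; congr (_ * _); rewrite /pt /axis [LHS](congr1 conjc (mulrC _ _)) conj_halfM rmorph_nat mulrC.
Qed.

Lemma in_ball_pt i : in_ball (pt i).
Proof.
have : (vnormsq (pt i))%:C = (4^-1 : R)%:C.
  by rewrite -hdot_vnormsq hdot_pt eqxx mulr1 fmorphV rmorph_nat.
by move=> /complexI; rewrite /in_ball => ->; rewrite invf_lt1 ?ltr1n ?ltr0n.
Qed.

Lemma gram_pt i j :
  hdot (normal (pt i)) (normal (pt j)) =
  (1 - kappa / 4 - expR (kappa * ln (3 / 4)))%:C * (i == j)%:R
   + hquad (pt i) * (hquad (pt j))^J.
Proof.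
have bi := in_ball_pt i; have bj := in_ball_pt j.
rewrite hdot_normal // hdot_pt.
suff h : rhoc a4 (f (pt i)) (f (pt j)) =
    if i == j then (expR (kappa * ln (3 / 4)))%:C else 1.
  have -> : hdot (f (pt i)) (f (pt j)) =
     1 + hquad (pt i) * (hquad (pt j))^J - rhoc a4 (f (pt i)) (f (pt j)).
    by rewrite rhoc_hquad; ring.
  have k4 : (kappa / 4)%:C = kappa%:C * 4^-1 by rewrite rmorphM fmorphV rmorph_nat.
  rewrite h !rmorphB rmorph1 /= k4; case: eqP => _.
    by rewrite (_ : true%:R = 1 :> C) //; ring.
  by rewrite (_ : false%:R = 0 :> C) //; ring.
have [eij|nij] := eqVneq i j.
  have d : hdot (pt i) (pt j) = (4^-1 : R)%:C.
    by rewrite hdot_pt eij eqxx mulr1 fmorphV rmorph_nat.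
  (* On the diagonal the comparison function is [(1 - t / 4)^kappa], written as a real exponential;
     at [t = 1] it gives [(3/4)^kappa]. *)
  pose L (t : R) := 1 - t / 4.
  have Lp (t : R) : 0 <= t <= 1 -> 0 < L t by rewrite /L => /andP[? ?]; lra.
  pose mu (t : R) := expR (kappa * ln (L t)).
  have dmu (t : R) : 0 <= t <= 1 ->
      is_derive t (1 : R) mu (mu t * (kappa * (- 4^-1 / L t))).
    move=> /Lp lt.
    have d1 : is_derive t (1 : R) L (- 4^-1).
      have h := is_deriveB (is_derive_cst (1 : R) t (1 : R)) (is_deriveZ (4^-1 : R) (is_derive_id t (1 : R))).
      have e : (cst 1 - 4^-1 \*: id) = L.
        by apply/funext => x; rewrite /L mulrC.
      rewrite -e; apply: is_derive_eq h _.
      by rewrite sub0r /GRing.scale /= mulr1.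
    have d2 := is_derive1_comp (is_derive1_ln lt) d1.
    have d3 := @is_derive1_comp _ (@expR R) (fun x => kappa * ln (L x)) _ _ _
      (is_derive_expR (kappa * ln (L t))) (is_deriveZ kappa d2).
    by apply: is_derive_eq d3 _; rewrite /GRing.scale /= /mu; ring.
  rewrite (@rhoc_f_comparison R n m P Q Q_neq0 kappa iso f0 (fun t => (mu t)%:C)
    (fun t => (mu t * (kappa * (- 4^-1 / L t)))%:C) _ _ bi bj).
  - by rewrite /mu /L (_ : 1 - 1 / 4 = 3 / 4) //; field.
  - by move=> t ht; exact: cderive_real (dmu t ht).
  - by move=> t ht; apply/eqP => /complexI e; have := expR_gt0 (kappa * ln (L t)); rewrite -/(mu t) e ltxx.
  - move=> t /Lp lt; rewrite d; apply: complexP => /=; last by ring.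
    rewrite /L in lt *; have l0 : 4 - t != 0 by rewrite gt_eqF //; lra.
    by field.
  - by rewrite /mu /L mul0r subr0 ln1 mulr0 expR0.
have d : hdot (pt i) (pt j) = 0 by rewrite hdot_pt (negbTE nij) mulr0.
rewrite (@rhoc_f_comparison R n m P Q Q_neq0 kappa iso f0 (fun=> 1) (fun=> 0) _ _ bi bj) //.
- by move=> t _; exact: cderive_cst.
- by move=> t _; rewrite d !mulr0 mul0r addr0.
Qed.

Lemma gram_comb (x : cpt n) :
  vnormsq (fun k => \sum_i x i * normal (pt i) k) =
  (1 - kappa / 4 - expR (kappa * ln (3 / 4))) * vnormsq x
   + csq (\sum_i x i * hquad (pt i)).
Proof.
apply: complexI; rewrite -hdot_vnormsq hdot_suml.
under eq_bigr do rewrite hdot_sumr.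
rewrite rmorphD rmorphM /= vnormsqE csqE; set c := (_%:C).
rewrite rmorph_sum mulr_suml mulr_sumr -big_split; apply: eq_bigr => i _ /=.
rewrite (eq_bigr (fun j => (x j)^J * (c * (j == i)%:R) + hquad (pt i) * (x j * hquad (pt j))^J)).
  by rewrite big_split /= sum_delta -mulr_sumr; ring.
by move=> j _; rewrite gram_pt -/c [i == j]eq_sym [(x j * _)^J]rmorphM; ring.
Qed.

Lemma kappa_eq1 : (1 < n)%N -> (m < 2 * n)%N -> kappa = 1.
Proof.
move=> n1 mn; set gam := 1 - kappa / 4 - expR (kappa * ln (3 / 4)).
have ly : ln (3 / 4 : R) != 0 by rewrite lt_eqF // ln_lt0 //; lra.
have e34 : expR (ln (3 / 4 : R)) = 3 / 4 by rewrite lnK // posrE; lra.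
have [k1|k1|//] := ltrgtP kappa 1; exfalso.
  (* Convexity with weight [kappa] at [y = ln (3/4)]: [(3/4)^kappa < 1 - kappa / 4]. *)
  have gpos : 0 < gam.
    have := @expR_strictly_convex R kappa _ _ ly; rewrite e34 kappa_gt0 k1 => /(_ isT).
    by rewrite /gam; lra.
  (* A relation between the Jacobian columns and the normal components: orthogonality kills [x],
     then the positive Gram form kills [y], contradicting nontriviality. *)
  have [x [y [[i xy] h]]] := linear_dependence jac0 (fun i => normal (pt i)) mn.
  have x0 j : x j = 0.
    have : hdot (fun k => \sum_i x i * jac0 i k + \sum_i y i * normal (pt i) k) (jac0 j) = 0.
      by rewrite /hdot big1 // => k _; rewrite h mul0r.
    have -> : (fun k => \sum_i x i * jac0 i k + \sum_i y i * normal (pt i) k) =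
              (fun k => \sum_i x i * jac0 i k - \sum_i (- y i) * normal (pt i) k).
      by apply/funext => k; congr (_ + _); rewrite -sumrN; apply: eq_bigr => l _; rewrite mulNr opprK.
    rewrite hdotBl !hdot_suml [X in _ - X]big1 => [|l _]; last first.
      by rewrite hdot_normal_jac0 ?mulr0 //; exact: in_ball_pt.
    under eq_bigr do rewrite hdot_jac0.
    rewrite sum_delta subr0 => /eqP; rewrite mulf_eq0 => /orP[/eqP/complexI e|/eqP//].
    by move: kappa_gt0; rewrite e ltxx.
  have : vnormsq (fun k => \sum_i y i * normal (pt i) k) = 0.
    rewrite /vnormsq big1 // => k _; apply/eqP; rewrite csq_eq0; have := h k.
    by rewrite big1 ?add0r => [->|l _]; rewrite ?x0 ?mul0r.
  rewrite gram_comb -/gam => e.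
  have y0 : vnormsq y = 0.
    have := vnormsq_ge0 y; have := csq_ge0 (\sum_i y i * hquad (pt i)).
    by move=> h1; rewrite le_eqVlt => /orP[/eqP //|h2]; have := mulr_gt0 gpos h2; lra.
  by move: xy; rewrite x0 (vnormsq_eq0 y0) eqxx.
(* The same convexity with weight [kappa^-1] at [y = kappa ln (3/4)], multiplied by [kappa]. *)
have gneg : gam < 0.
  have k0 : kappa != 0 by rewrite gt_eqF.
  have := @expR_strictly_convex R kappa^-1 (kappa * ln (3 / 4)) _ _.
  rewrite invr_gt0 kappa_gt0 invf_lt1 // k1 => /(_ isT); rewrite mulf_neq0 // => /(_ isT).
  rewrite mulKf // e34 -(ltr_pM2l kappa_gt0).
  have -> : kappa * (kappa^-1 * expR (kappa * ln (3 / 4)) + (1 - kappa^-1)) =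
     expR (kappa * ln (3 / 4)) + kappa - 1 by field.
  by rewrite /gam; lra.
pose i0 := Ordinal (ltnW n1 : (0 < n)%N); pose i1 := Ordinal n1.
have i01 : i1 != i0 by [].
(* On the kernel of the linear form [x |-> sum x_i h(e_i / 2)] the Gram form is [gam] times the
   squared norm, so a nonzero kernel vector would have negative norm. Two coordinates suffice to
   find one. *)
suff [x [x0 hx]] : exists x : cpt n, 0 < vnormsq x /\ \sum_i x i * hquad (pt i) = 0.
  have := gram_comb x; rewrite hx -/gam => e.
  have := vnormsq_ge0 (fun k => \sum_i x i * normal (pt i) k); rewrite e.
  have := mulr_gt0 (_ : 0 < - gam) x0; rewrite oppr_gt0 => /(_ gneg).
  by rewrite mulNr /csq /=; lra.
have sum2 (x : cpt n) : (forall i, i != i0 -> i != i1 -> x i = 0) ->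
   \sum_i x i * hquad (pt i) = x i0 * hquad (pt i0) + x i1 * hquad (pt i1).
  move=> h; rewrite (bigD1 i0) //= (bigD1 i1) //= big1 ?addr0 // => i /andP[a b].
  by rewrite h ?mul0r.
have pos (x : cpt n) i : x i != 0 -> 0 < vnormsq x.
  move=> xi; rewrite lt_def vnormsq_ge0 andbT; apply: contra xi => /eqP /vnormsq_eq0 ->.
  by [].
have [h0|h0] := eqVneq (hquad (pt i0)) 0.
  exists (fun i => (i == i0)%:R); split; first by apply: (pos _ i0); rewrite eqxx oner_neq0.
  rewrite sum2 => [|i /negbTE -> //]; by rewrite h0 mulr0 (negbTE i01) mul0r addr0.
exists (fun i => if i == i0 then hquad (pt i1) else if i == i1 then - hquad (pt i0) else 0).
split; first by apply: (pos _ i1); rewrite (negbTE i01) eqxx oppr_eq0.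
rewrite sum2 => [|i /negbTE -> /negbTE -> //].
by rewrite !eqxx (negbTE i01); ring.
Qed.

End IsometryConstant.

(** * The normal form [f = A z + h u] *)

Section NormalForm.
Context {R : realType}.
Local Notation C := R[i].
Local Notation cpoly n := (mpoly.mpoly n C).
Local Notation cpt := (@cpt R).

Variables (n m : nat) (P : 'I_m -> cpoly n) (Q : cpoly n).
Hypothesis Q_neq0 : forall z, in_ball z -> peval z Q != 0.
Local Notation f := (ratmap P Q).
Local Notation df := (dratmap P Q).
Local Notation a4 := (4^-1 : R).
Hypothesis iso : forall z, in_ball z -> forall i j,
    (\sum_k \sum_l loghess a4 (f z) (f z) k l * df z k i * (df z l j)^J)
      * rhoc 0 z z ^+ 2 =
    1%:C * loghess 0 z z i j * rhoc a4 (f z) (f z) ^+ 2.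
Hypothesis f0 : f (fun=> 0) = fun=> 0.
Hypothesis mn : (m < 2 * n)%N.
Local Notation A := (jac0 P Q).
Local Notation h := (hquad P Q).
Local Notation N := (normal P Q).

Lemma hdot_AA i j : hdot (A i) (A j) = (i == j)%:R.
Proof. by rewrite (hdot_jac0 Q_neq0 iso f0) mul1r. Qed.

(** For [kappa = 1] the comparison function is affine in [t], so complex values of [hdot z w] cause
    no difficulty. *)
Lemma rhoc_f z w : in_ball z -> in_ball w -> rhoc a4 (f z) (f w) = 1 - hdot z w.
Proof.
move=> hz hw; have hs (t : R) : 0 <= t <= 1 -> 1 - t%:C * hdot z w != 0.
  move=> ht; have -> : t%:C * hdot z w = hdot (fun k => t%:C * z k) w.
    by rewrite /hdot mulr_sumr; apply: eq_bigr => k _; rewrite mulrA.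
  exact: hdot_neq1 (in_ball_scale ht hz) hw.
rewrite (@rhoc_f_comparison R n m P Q Q_neq0 1 iso f0 (fun t => 1 - t%:C * hdot z w)
   (fun=> - hdot z w) z w hz hw) //.
- by rewrite mul1r.
- move=> t _; apply: cderive_eq (cderiveB (cderive_cst 1 t)
     (cderiveM (cderive_id t) (cderive_cst (hdot z w) t))) _.
  by rewrite mul1r mulr0 addr0 sub0r.
- by move=> t _; ring.
- by rewrite mul0r subr0.
Qed.

Lemma hdot_NN z w : in_ball z -> in_ball w -> hdot (N z) (N w) = h z * (h w)^J.
Proof.
move=> hz hw; rewrite (hdot_normal Q_neq0 iso f0) // mul1r.
have -> : hdot (f z) (f w) = 1 + h z * (h w)^J - rhoc a4 (f z) (f w).
  by rewrite rhoc_hquad; ring.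
by rewrite rhoc_f //; ring.
Qed.

Definition jacmap (z : cpt n) : cpt m := fun k => \sum_j z j * A j k.

Lemma jacmap_inj x : (forall k, jacmap x k = 0) -> forall j, x j = 0.
Proof.
move=> hx j; have : hdot (jacmap x) (A j) = 0 by rewrite /hdot big1 // => k _; rewrite hx mul0r.
rewrite hdot_suml (bigD1 j) //= big1 => [|i ij]; last by rewrite hdot_AA (negbTE ij) mulr0.
by rewrite hdot_AA eqxx addr0 mulr1.
Qed.

(* An isotropic subspace of [C^m] has dimension at most [m / 2], and [2 n > m]. *)
Lemma jacmap_not_isotropic : ~ (forall z, vsqsum (jacmap z) = 0).
Proof.
move=> iso0.
have bil x y : \sum_k jacmap x k * jacmap y k = 0.
  have e : vsqsum (jacmap (fun j => x j + y j)) =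
     vsqsum (jacmap x) + vsqsum (jacmap y) + 2 * \sum_k jacmap x k * jacmap y k.
    rewrite /vsqsum mulr_sumr -!big_split /=; apply: eq_bigr => k _.
    have -> : jacmap (fun j => x j + y j) k = jacmap x k + jacmap y k.
      by rewrite /jacmap -big_split; apply: eq_bigr => j _; rewrite mulrDl.
    by ring.
  move: e; rewrite !iso0 !add0r => /esym/eqP; rewrite mulf_eq0 pnatr_eq0 /=.
  by move=> /eqP.
(* A relation between the columns of [A] and their conjugates makes [A x] minus the conjugate of
   [A y']; isotropy then gives [|A x|^2 = - (A x).(A y') = 0]. *)
have [x [y [[i xy] e]]] := linear_dependence A (fun i k => (A i k)^J) mn.
pose y' : cpt n := fun j => (y j)^J.
have ey k : jacmap y' k = - (jacmap x k)^J.
  have -> : jacmap y' k = (\sum_i y i * (A i k)^J)^J.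
    by rewrite rmorph_sum; apply: eq_bigr => j _; rewrite rmorphM /= conjcK.
  have := e k; rewrite addrC => /eqP; rewrite addr_eq0 => /eqP ->.
  by rewrite rmorphN.
have jx : vnormsq (jacmap x) = 0.
  apply: complexI; rewrite vnormsqE.
  transitivity (- \sum_k jacmap x k * jacmap y' k); last by rewrite bil oppr0.
  by rewrite -sumrN; apply: eq_bigr => k _; rewrite ey mulrN opprK.
have kx := vnormsq_eq0 jx.
have x0 := jacmap_inj kx.
have y0 j : y' j = 0 by apply: jacmap_inj => k; rewrite ey kx rmorph0 oppr0.
have yi : y i = 0 by rewrite -[y i]conjcK -/(y' i) y0 rmorph0.
by move: xy; rewrite x0 yi eqxx.
Qed.

Definition jacpoly (k : 'I_m) : cpoly n := \sum_j A j k *: mpolyX C U_(j)%MM.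

Lemma peval_jacpoly z k : peval z (jacpoly k) = jacmap z k.
Proof.
rewrite /peval /jacpoly raddf_sum; apply: eq_bigr => j _.
by rewrite /= mevalZ mevalXU mulrC.
Qed.

Definition quadpoly : cpoly n := \sum_k jacpoly k ^+ 2.

Lemma peval_quadpoly z : peval z quadpoly = vsqsum (jacmap z).
Proof.
rewrite /peval /quadpoly raddf_sum; apply: eq_bigr => k _.
by rewrite /= rmorphXn /= -/(peval z _) peval_jacpoly.
Qed.

Lemma quadpoly_neq0 : quadpoly != 0.
Proof.
apply/eqP => q0; apply: jacmap_not_isotropic => z.
by rewrite -peval_quadpoly q0 /peval meval0.
Qed.

(** If [h] vanished on the ball, so would the normal component; then [f = A z] and
    [A z . A z = 2 h = 0], against [quadpoly_neq0]. *)
Lemma hquad_neq0 : exists2 z, in_ball z & h z != 0.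
Proof.
apply: contrapT => hn.
have h0 z : in_ball z -> h z = 0.
  by move=> hz; apply/eqP; apply: contrapT => /negP hz0; apply: hn; exists z.
apply: (negP quadpoly_neq0); apply/eqP/cpoly_ball_eq0 => z hz.
rewrite peval_quadpoly.
have Nz k : N z k = 0.
  apply: vnormsq_eq0; apply: complexI.
  by rewrite -hdot_vnormsq hdot_NN // h0 // mul0r.
have -> : jacmap z = f z.
  by apply/funext => k; have /eqP := Nz k; rewrite subr_eq0 => /eqP ->.
by have /eqP := h0 z hz; rewrite mulf_eq0 invr_eq0 pnatr_eq0 /= => /eqP.
Qed.

(** The Gram kernel [h z (h w)^J] of the normal components has rank one, so each is [h z] times the
    fixed vector [N z0 / h z0]: the squared norm of the difference expands to zero. *)
Lemma normal_form : exists u : cpt m,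
  [/\ forall z k, in_ball z -> f z k = jacmap z k + h z * u k,
      hdot u u = 1 & forall z, hdot (jacmap z) u = 0].
Proof.
have [z0 hz0 h0] := hquad_neq0.
have h0J : (h z0)^J != 0 by rewrite conjc_eq0.
(* The scalar multiple is written as a one-term sum so that [hdot_suml] and [hdot_sumr] apply. *)
pose u : cpt m := fun k => \sum_(i < 1) (h z0)^-1 * N z0 k.
have Nu v : hdot v u = ((h z0)^J)^-1 * hdot v (N z0).
  by rewrite (hdot_sumr (fun=> (h z0)^-1) v (fun=> N z0)) big_ord1 fmorphV.
have uN v : hdot u v = (h z0)^-1 * hdot (N z0) v.
  by rewrite (hdot_suml (fun=> (h z0)^-1) (fun=> N z0)) big_ord1.
have uu : hdot u u = 1.
  rewrite Nu uN hdot_NN //.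
  by field; rewrite h0 h0J.
exists u; split => //; last first.
  move=> z; rewrite Nu hdot_suml big1 ?mulr0 // => j _.
  by rewrite hdotC (hdot_normal_jac0 Q_neq0 iso f0) // rmorph0 mulr0.
move=> z k hz.
pose v : cpt m := fun k => N z k - \sum_(i < 1) h z * u k.
have v0 : vnormsq v = 0.
  apply: complexI; rewrite -hdot_vnormsq (hdotBl (N z)) !(hdotBr _ (N z)).
  rewrite !(hdot_suml (fun=> h z) (fun=> u)) !(hdot_sumr (fun=> h z) _ (fun=> u)) !big_ord1.
  by rewrite uu Nu uN !hdot_NN //; field; rewrite h0 h0J.
have /eqP := vnormsq_eq0 v0 k; rewrite subr_eq0 big_ord1 => /eqP <-.
by rewrite /normal addrC subrK.
Qed.

End NormalForm.

(** * Discriminants of rational roots and divisibility by affine polynomials *)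

Section PolynomialAlgebra.
Context {R : realType}.
Local Notation C := R[i].
Local Notation cpoly n := (mpoly.mpoly n C).
Local Notation cpt := (@cpt R).

Lemma cpoly_ball_eq n (p q : cpoly n) :
  (forall z, in_ball z -> peval z p = peval z q) -> p = q.
Proof.
move=> h; apply/eqP; rewrite -subr_eq0; apply/eqP/cpoly_ball_eq0 => z hz.
by rewrite /peval mevalB -!/(peval _ _) h ?subrr.
Qed.

Lemma poly_ext (p q : {poly C}) : (forall s, p.[s] = q.[s]) -> p = q.
Proof.
move=> h; apply/eqP; rewrite -subr_eq0; apply/eqP/poly_near0_eq0.
by near=> t; rewrite hornerD hornerN h subrr.
Unshelve. all: by end_near. Qed.

(* A rational solution [h = u / v] of [c h^2 + 2 (l s - 1) h + q s^2 = 0] forces the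
   discriminant [(1 - l s)^2 - c q s^2] to be the square of a polynomial in [s]. *)
Lemma rational_root_discriminant (u v : {poly C}) (c q l : C) : v != 0 ->
  (forall s, 2 * u.[s] * v.[s] =
     q * s ^+ 2 * v.[s] ^+ 2 + 2 * l * s * u.[s] * v.[s] + c * u.[s] ^+ 2) ->
  c * q = 0.
Proof.
move=> v0 h.
pose D : {poly C} := (1%:P - l *: 'X) ^+ 2 - (c * q) *: 'X ^+ 2.
(* Completing the square: multiplied by [c], the equation reads [T^2 = D v^2]. Hence [v] divides
   [T], and [D] is the square of the quotient. *)
pose T : {poly C} := c *: u - (1%:P - l *: 'X) * v.
have TD : T ^+ 2 = D * v ^+ 2.
  apply: poly_ext => s; apply/eqP; rewrite -subr_eq0.
  have -> : (T ^+ 2).[s] - (D * v ^+ 2).[s] =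
     c * (q * s ^+ 2 * v.[s] ^+ 2 + 2 * l * s * u.[s] * v.[s] + c * u.[s] ^+ 2
          - 2 * u.[s] * v.[s]).
    rewrite /T /D !(hornerD, hornerN, hornerZ, hornerM, horner_exp, hornerX, hornerC).
    by ring.
  by rewrite h subrr mulr0.
have vT : v %| T by rewrite -(@dvdp_pexp2r _ v T 2) // TD dvdp_mull.
have /dvdpP [s es] := vT.
have sD : s ^+ 2 = D.
  by apply: (mulIf (expf_neq0 2 v0)); rewrite -TD es exprMn.
have sD3 : (size D <= 3)%N.
  rewrite /D (leq_trans (size_polyD _ _)) // geq_max; apply/andP; split.
    have s2 : (size ((1%:P - l *: 'X)%R : {poly C}) <= 2)%N.
      rewrite (leq_trans (size_polyD _ _)) // geq_max size_polyC size_polyN oner_eq0 /=.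
      by rewrite (leq_trans (size_scale_leq _ _)) ?size_polyX.
    rewrite expr2 (leq_trans (size_polyMleq _ _)) //.
    by move: s2; case: (size _) => [|[|[|]]].
  by rewrite size_polyN (leq_trans (size_scale_leq _ _)) ?size_polyXn.
have ss : (size s <= 2)%N.
  have [->|s0] := eqVneq s 0; first by rewrite size_poly0.
  move: sD3; rewrite -sD expr2 size_mul //.
  by case: (size s) => [|[|[|k]]] //; rewrite !(addnS, addSn).
have es2 t : s.[t] = s`_0 + s`_1 * t.
  rewrite (horner_coef_wide _ ss) big_ord_recl big_ord1 /= expr0 expr1 mulr1.
  by [].
have ev t : (s`_0 + s`_1 * t) ^+ 2 = (1 - l * t) ^+ 2 - c * q * t ^+ 2.
  by rewrite -es2 -horner_exp sD /D !(hornerD, hornerN, hornerZ, hornerM, horner_exp, hornerX, hornerC).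
set a := s`_0 in ev *; set b := s`_1 in ev *.
have e0 := ev 0; have e1 := ev 1; have e2 := ev (-1).
(* The values at 0, 1 and -1 give [a^2 = 1] and [a b = - l], hence [b^2 = l^2]; against the leading
   coefficient [l^2 - c q] of [D] this leaves [c q = 0]. *)
have ha : a ^+ 2 = 1 by move: e0; rewrite !mulr0 addr0 subr0 expr1n expr0n mulr0 subr0.
have hab : a * b = - l.
  have : 4 * (a * b) = 4 * - l.
    transitivity ((a + b * 1) ^+ 2 - (a + b * -1) ^+ 2); first by ring.
    by rewrite e1 e2; ring.
  by apply: mulfI; rewrite pnatr_eq0.
have hb : b ^+ 2 = l ^+ 2.
  by rewrite -[LHS]mul1r -ha -exprMn hab sqrrN.
have : c * q = (1 - l * 1) ^+ 2 - (a + b * 1) ^+ 2 by rewrite e1; ring.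
move=> ->; have -> : (a + b * 1) ^+ 2 = a ^+ 2 + 2 * (a * b) + b ^+ 2 by ring.
by rewrite ha hab hb; ring.
Qed.

Lemma mulrDD_congr (S : comNzRingType) (b x1 x2 t1 t2 : S) :
  (x1 + b * t1) * (x2 + b * t2) = x1 * x2 + b * (x1 * t2 + t1 * x2 + b * t1 * t2).
Proof. by ring. Qed.

Lemma mul_eq0_cancel (S : idomainType) (x y : S) : x != 0 -> x * y = 0 -> y = 0.
Proof. by move=> x0 /eqP; rewrite mulf_eq0 (negbTE x0) => /eqP. Qed.

Section AffineDivisor.
Variables (n : nat) (l : 'I_n -> C).

Definition linpoly : cpoly n := \sum_j l j *: mpolyX C U_(j)%MM.

Lemma peval_linpoly z : peval z linpoly = \sum_j l j * z j.
Proof.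
rewrite /peval /linpoly raddf_sum; apply: eq_bigr => j _.
by rewrite /= mevalZ mevalXU.
Qed.

(* If [l i != 0], solving [linpoly = 1] for the variable [X_i] gives a retraction of the
   polynomial ring whose kernel is generated by [1 - linpoly]; being a morphism to a
   domain, it shows that [1 - linpoly] is prime. *)
Lemma affine_prime (q p s : cpoly n) i : l i != 0 ->
  (forall (c : C) z, peval (fun k => c * z k) q = c ^+ 2 * peval z q) -> q != 0 ->
  q * p = (1 - linpoly) * s -> exists p', p = (1 - linpoly) * p'.
Proof.
move=> li hq q0 e; pose b := 1 - linpoly.
pose subst j : cpoly n :=
  if j == i then mpolyX C U_(i)%MM + (l i)^-1 *: b else mpolyX C U_(j)%MM.
pose phi (r : cpoly n) : cpoly n := r \mPo [tuple subst j | j < n].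
have phiX j : phi (mpolyX C U_(j)%MM) = subst j.
  by rewrite /phi comp_mpolyXU -tnth_nth tnth_mktuple.
have phi_mod r : exists t, r = phi r + b * t.
  elim/(@mpoly_ring_ind R): r => [c|j|r1 r2 [t1 e1] [t2 e2]|r1 r2 [t1 e1] [t2 e2]].
  - by exists 0; rewrite /phi comp_mpolyC mulr0 addr0.
  - rewrite phiX /subst; case: eqP => [->|_]; last by exists 0; rewrite mulr0 addr0.
    by exists (- (l i)^-1)%:MP; rewrite mulrC mul_mpolyC scaleNr addrK.
  - by exists (t1 + t2); rewrite {1}e1 {1}e2 /phi comp_mpolyD mulrDr addrACA.
  - exists (phi r1 * t2 + t1 * phi r2 + b * t1 * t2).
    have -> : phi (r1 * r2) = phi r1 * phi r2 by exact: rmorphM.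
    by rewrite {1}e1 {1}e2 mulrDD_congr.
have ev r z : peval z (phi r) = peval (fun j => peval z (subst j)) r.
  rewrite /peval /phi comp_mpoly_meval; apply: meval_eq => j.
  by rewrite tnth_mktuple.
have fixed z : \sum_j l j * z j = 1 -> (fun j => peval z (subst j)) = z.
  move=> hz; apply/funext => j; rewrite /subst; case: eqP => [->|_].
    rewrite /peval mevalD mevalZ mevalXU mevalB meval1 -/(peval z linpoly).
    by rewrite peval_linpoly hz subrr mulr0 addr0.
  by rewrite /peval mevalXU.
have sol z : \sum_j l j * peval z (subst j) = 1.
  rewrite (bigD1 i) //= /subst eqxx (eq_bigr (fun j => l j * z j)); last first.
    by move=> j /negbTE ->; rewrite /peval mevalXU.
  rewrite /peval mevalD mevalZ mevalXU mevalB meval1 -/(peval z linpoly).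
  rewrite peval_linpoly (bigD1 i) //= mulrDr mulrA divff // mul1r; ring.
have phib : phi b = 0.
  apply: cpoly_ball_eq0 => z _.
  rewrite ev /peval mevalB meval1 -/(peval _ linpoly) peval_linpoly.
  by rewrite sol subrr.
(* If [phi q = 0], then [q] vanishes on the hyperplane [linpoly = 1], and by homogeneity wherever
   [linpoly] is nonzero; so [q * linpoly = 0] in a domain. *)
have phiq : phi q != 0.
  apply/eqP => pq.
  have ql : q * linpoly = 0.
    apply: cpoly_ball_eq0 => z _; rewrite /peval mevalM -!/(peval _ _) peval_linpoly.
    have [->|lz] := eqVneq (\sum_j l j * z j) 0; first by rewrite mulr0.
    suff -> : peval z q = 0 by rewrite mul0r.
    pose c := \sum_j l j * z j; pose w : cpt n := fun k => c^-1 * z k.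
    have w1 : \sum_j l j * w j = 1.
      rewrite (eq_bigr (fun j => c^-1 * (l j * z j))); last by move=> j _; rewrite mulrCA.
      by rewrite -mulr_sumr mulVf.
    have qw : peval w q = 0 by rewrite -(fixed w w1) -ev pq /peval meval0.
    have -> : z = fun k => c * w k by apply/funext => k; rewrite /w mulrA divff ?mul1r.
    by rewrite hq qw mulr0.
  move/eqP: ql; rewrite mulf_eq0 (negbTE q0) /= => /eqP l0.
  pose z : cpt n := axis 1 i.
  have : peval z linpoly = 0 by rewrite l0 /peval meval0.
  by rewrite peval_linpoly axis_sum mulr1 => /eqP; rewrite (negbTE li).
have pqp : phi q * phi p = 0.
  by rewrite /phi -rmorphM /= e rmorphM /= -/(phi _) -/b phib mul0r.
have pp : phi p = 0 := mul_eq0_cancel phiq pqp.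
by have [t et] := phi_mod p; exists t; rewrite {1}et pp add0r.
Qed.

End AffineDivisor.
End PolynomialAlgebra.

(** * Extraction of the degree from the normal form *)

Section Degree.
Context {R : realType}.
Local Notation C := R[i].
Local Notation cpoly n := (mpoly.mpoly n C).
Local Notation cpt := (@cpt R).

(** [msize] is the total degree plus one for nonzero polynomials; [a] and [b] are the degree bounds
    themselves. *)
Lemma msizeM_leq n (p q : cpoly n) (a b : nat) :
  (msize p <= a.+1)%N -> (msize q <= b.+1)%N -> (msize (p * q)%R <= (a + b).+1)%N.
Proof.
move=> pa qb; have [->|p0] := eqVneq p 0; first by rewrite mul0r mmeasure0.
have [->|q0] := eqVneq q 0; first by rewrite mulr0 mmeasure0.
rewrite msizeM //; apply: leq_trans (_ : (a.+1 + b.+1).-1 <= _)%N.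
  by rewrite -!subn1 leq_sub2r // leq_add.
by rewrite addSn addnS.
Qed.

Lemma msizeD_leq n (p q : cpoly n) a :
  (msize p <= a)%N -> (msize q <= a)%N -> (msize (p + q)%R <= a)%N.
Proof. by move=> pa qa; rewrite (leq_trans (mmeasureD_le _ _ _)) // geq_max pa. Qed.

Lemma msize_sum_leq n (I : finType) (F : I -> cpoly n) a :
  (forall i, (msize (F i) <= a)%N) -> (msize (\sum_i F i)%R <= a)%N.
Proof.
move=> h; rewrite (leq_trans (mmeasure_sum _ _ _ _)) //.
by apply/bigmax_leqP => i _.
Qed.

Lemma msize_linear n (l : 'I_n -> C) : (msize (linpoly l) <= 2)%N.
Proof.
apply: msize_sum_leq => j; apply: leq_trans (msizeZ_le _ _) _.
by rewrite msizeX mdeg1.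
Qed.

Lemma jacpoly_linpoly n m (P : 'I_m -> cpoly n) Q k :
  jacpoly P Q k = linpoly (fun j => jac0 P Q j k).
Proof. by []. Qed.

Lemma msize_quadpoly n m (P : 'I_m -> cpoly n) Q :
  quadpoly P Q != 0 -> msize (quadpoly P Q) = 3.
Proof.
move=> q0; have h : quadpoly P Q \is 2.-homog for mdeg.
  apply: rpred_sum => k _; rewrite expr2.
  have hj : jacpoly P Q k \is 1.-homog for mdeg.
    by apply: rpred_sum => j _; apply: rpredZ; rewrite dhomogX; apply/eqP; exact: mdeg1.
  exact: (dhomogM hj hj).
have := dhomog_uniq q0 (dhomog_msize h) h.
by case: (msize _) => [|k] //= ->.
Qed.

Variables (n m : nat) (P : 'I_m -> cpoly n) (Q : cpoly n).
Hypothesis Q_neq0 : forall z, in_ball z -> peval z Q != 0.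
Local Notation f := (ratmap P Q).
Hypothesis quad0 : quadpoly P Q != 0.
Variable u : cpt m.
Hypothesis form : forall z k, in_ball z -> f z k = jacmap P Q z k + hquad P Q z * u k.
Hypothesis uu : hdot u u = 1.
Hypothesis ju : forall z, hdot (jacmap P Q z) u = 0.
Hypothesis low : lowest_terms P Q.

Local Notation q := (quadpoly P Q).
Local Notation h := (hquad P Q).
(** [l] and [c] come from the bilinear product without conjugation, whereas [ju] and [uu] concern
    the hermitian one. *)
Let l (j : 'I_n) : C := \sum_k jac0 P Q j k * u k.
Let c : C := \sum_k u k ^+ 2.
(** The numerator of [h]: the hermitian product of the normal form with the unit vector [u] isolates
    [h] as [H / Q]. *)
Let H : cpoly n := \sum_k (u k)^J *: P k.
Let o : cpt n := fun=> 0.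

Let Q0 : Q != 0.
Proof.
have := Q_neq0 (@in_ball0 R n); apply: contraNneq => ->.
by rewrite /peval meval0.
Qed.

Lemma peval_normal_numerator z : peval z H = \sum_k (u k)^J * peval z (P k).
Proof.
rewrite /peval raddf_sum; apply: eq_bigr => k _; exact: mevalZ.
Qed.

Lemma hquadE z : in_ball z -> h z = peval z H / peval z Q.
Proof.
move=> hz; have -> : peval z H / peval z Q = hdot (f z) u.
  rewrite peval_normal_numerator mulr_suml; apply: eq_bigr => k _.
  by rewrite /ratmap [RHS]mulrC mulrA.
have -> : hdot (f z) u = hdot (jacmap P Q z) u + h z * hdot u u.
  rewrite /hdot mulr_sumr -big_split; apply: eq_bigr => k _ /=.
  by rewrite form // mulrDl mulrA.
by rewrite ju uu add0r mulr1.
Qed.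

Lemma numeratorE k : P k = jacpoly P Q k * Q + u k *: H.
Proof.
apply: cpoly_ball_eq => z hz; have := form k hz; rewrite hquadE // /ratmap => e.
rewrite /peval mevalD mevalM mevalZ -!/(peval _ _) peval_jacpoly.
have hQ := Q_neq0 hz.
rewrite -[LHS](divfK hQ) e; field; exact: hQ.
Qed.

Lemma peval_lin z : peval z (linpoly l) = \sum_k jacmap P Q z k * u k.
Proof.
rewrite peval_linpoly /l /jacmap.
under eq_bigr do rewrite mulr_suml; rewrite exchange_big; apply: eq_bigr => k _.
by rewrite mulr_suml; apply: eq_bigr => j _ /=; ring.
Qed.

(** The expansion of [f.f = 2 h] with [f = A z + h u], multiplied by [Q ^+ 2]. *)
Lemma quadratic_equation :
  2 *: (H * Q) = q * Q ^+ 2 + 2 *: (H * Q * linpoly l) + c *: H ^+ 2.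
Proof.
apply: cpoly_ball_eq => z hz.
rewrite /peval !mevalD !mevalZ !mevalM -!/(peval _ _).
rewrite peval_lin peval_quadpoly.
have hQ := Q_neq0 hz.
have e : 2 * h z = vsqsum (jacmap P Q z) + 2 * h z * (\sum_k jacmap P Q z k * u k)
    + c * h z ^+ 2.
  transitivity (vsqsum (f z)); first by rewrite /hquad mulrA divff ?mul1r // pnatr_eq0.
  rewrite /vsqsum /c mulr_sumr mulr_suml -!big_split; apply: eq_bigr => k _ /=.
  by rewrite form //; ring.
move: e; rewrite hquadE //; set S := \sum_k _; set V := vsqsum _ => e.
transitivity ((2 * (peval z H / peval z Q)) * peval z Q ^+ 2); first by field.
by rewrite e; field.
Qed.

Lemma c_eq0 : c = 0.
Proof.
have [z0 hz0 q0] : exists2 z, in_ball z & peval z q != 0.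
  apply: contrapT => hn; apply: (negP quad0); apply/eqP/cpoly_ball_eq0 => z hz.
  by apply/eqP; apply: contrapT => /negP qz; apply: hn; exists z.
(* Restriction to the complex line through 0 and a point where [q] is nonzero yields a rational root
   in one variable. *)
have [h1 eh1] := peval_cline_poly o z0 H; have [v1 ev1] := peval_cline_poly o z0 Q.
have v0 : v1 != 0.
  apply/eqP => v10; have := ev1 0; rewrite cline0 v10 horner0 => e.
  by have := Q_neq0 (@in_ball0 R n); rewrite e eqxx.
have cs s : cline o z0 s = fun k => s * z0 k by apply/funext => k; rewrite /cline add0r.
have js s k : jacmap P Q (cline o z0 s) k = s * jacmap P Q z0 k.
  by rewrite cs /jacmap mulr_sumr; apply: eq_bigr => j _; rewrite mulrA.
have := @rational_root_discriminant R h1 v1 c (peval z0 q) (peval z0 (linpoly l)) v0.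
move=> /(_ _)/eqP; rewrite mulf_eq0 (negbTE q0) orbF => hc; apply/eqP/hc => s.
have := congr1 (peval (cline o z0 s)) quadratic_equation.
rewrite /peval !mevalD !mevalZ !mevalM -!/(peval _ _).
rewrite eh1 ev1 !peval_lin !peval_quadpoly.
have -> : vsqsum (jacmap P Q (cline o z0 s)) = s ^+ 2 * vsqsum (jacmap P Q z0).
  by rewrite /vsqsum mulr_sumr; apply: eq_bigr => k _; rewrite js exprMn.
have -> : \sum_k jacmap P Q (cline o z0 s) k * u k = s * \sum_k jacmap P Q z0 k * u k.
  by rewrite mulr_sumr; apply: eq_bigr => k _; rewrite js mulrA.
move=> e; transitivity (2 * (h1.[s] * v1.[s])); first by rewrite mulrA.
by rewrite e; ring.
Qed.

Lemma linear_equation : 2 *: H * (1 - linpoly l) = q * Q.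
Proof.
apply: (mulIf Q0); have := quadratic_equation; rewrite c_eq0 scale0r addr0 => e.
rewrite -[RHS]mulrA -expr2 -[RHS](addrK (2 *: (H * Q * linpoly l))) -e.
by rewrite -!scalerAl -scalerBr; congr (_ *: _); rewrite mulrBr mulr1 mulrBl mulrAC.
Qed.

(** By [linear_equation], [1 - linpoly l] divides [q * Q], and [affine_prime] moves the divisibility
    to [Q]. When [l = 0] the factor is 1. *)
Lemma denominator_factor : exists Q', Q = (1 - linpoly l) * Q'.
Proof.
have [/existsP [i li]|] := boolP [exists i, l i != 0].
  apply: (@affine_prime R n l q Q (2 *: H) i li) => //; last first.
    by rewrite -linear_equation mulrC.
  move=> a z; rewrite !peval_quadpoly /vsqsum mulr_sumr; apply: eq_bigr => k _.
  rewrite -exprMn /jacmap mulr_sumr; congr (_ ^+ 2); apply: eq_bigr => j _.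
  exact/esym/mulrA.
rewrite negb_exists => /forallP hl; exists Q.
have -> : linpoly l = 0; last by rewrite subr0 mul1r.
rewrite /linpoly big1 // => j _; move: (hl j); rewrite negbK => /eqP ->.
by rewrite scale0r.
Qed.

Lemma rat_deg_eq2 : rat_deg P Q = 2%N.
Proof.
have [Q' eQ] := denominator_factor; set b := 1 - linpoly l in eQ.
have b0 : b != 0 by apply: contraNneq Q0 => b0; rewrite eQ b0 mul0r.
have eH : 2 *: H = q * Q'.
  apply: (mulIf b0); rewrite linear_equation -mulrA [Q' * b]mulrC.
  by congr (_ * _); exact: eQ.
have eP k : P k = (jacpoly P Q k * b + (u k / 2) *: q) * Q'.
  transitivity (jacpoly P Q k * Q + u k *: H); first exact: numeratorE.
  rewrite mulrDl -[in RHS]mulrA; congr (_ * _ + _); first exact: eQ.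
  by rewrite -scalerAl -eH scalerA divfK // pnatr_eq0.
have Q'0 : Q' != 0 by apply: contraNneq Q0 => Q'0; rewrite eQ Q'0 mulr0.
(* [Q'] divides the denominator and every numerator, so lowest terms make it a nonzero constant. *)
have sQ' : msize Q' = 1%N.
  have := low (q := Q').
  have dQ : pdvd Q' Q by exists b; rewrite mulrC.
  have dP k : pdvd Q' (P k) by exists (jacpoly P Q k * b + (u k / 2) *: q); rewrite mulrC.
  move=> /(_ dQ dP); have : msize Q' != 0%N by rewrite mmeasure_poly_eq0.
  by case: (msize Q') => [|[|]].
have sb : (msize b <= 2)%N.
  apply: msizeD_leq; first by rewrite msize1.
  by rewrite mmeasureN; exact: msize_linear.
have sq : msize q = 3 := msize_quadpoly quad0.
have sP k : (msize (P k) <= 3)%N.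
  rewrite eP; apply: (@msizeM_leq _ _ _ 2 0); last by rewrite sQ'.
  apply: msizeD_leq; last by rewrite (leq_trans (msizeZ_le _ _)) // sq.
  by apply: (@msizeM_leq _ _ _ 1 1) => //; rewrite jacpoly_linpoly; exact: msize_linear.
have sQ : (msize Q <= 3)%N.
  rewrite eQ; apply: (@msizeM_leq _ _ _ 2 0); last by rewrite sQ'.
  exact: leq_trans sb _.
(* Were all numerators of degree at most 1, so would be [H]; but [2 H = q Q'] has degree 2. *)
have [k sk] : exists k, (2 < msize (P k))%N.
  apply/existsP; apply: contraT; rewrite negb_exists => /forallP hs.
  have : (msize H <= 2)%N.
    by apply: msize_sum_leq => k; rewrite (leq_trans (msizeZ_le _ _)) // leqNgt.
  rewrite -(@msizeZ _ _ 2) ?pnatr_eq0 // eH msizeM // sq sQ' //.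
apply/eqP; rewrite eqn_leq /rat_deg geq_max; apply/andP; split.
  apply/andP; split; last by case: (msize Q) sQ.
  by apply/bigmax_leqP => i _; case: (msize (P i)) (sP i).
rewrite leq_max (leq_trans _ (leq_bigmax k)) //.
by case: (msize (P k)) sk.
Qed.

End Degree.

Theorem mainTheorem9 (R : realType) (n m : nat) (F : @cpt R n -> @cpt R m) :
  (3 <= n.+1)%N -> (n.+1 <= m)%N -> (m < 2 * n)%N ->
  (forall z : @cpt R n, in_ball z -> in_DIV (F z)) ->
  holo_isometry F ->
  is_rational_map F ->
  F (fun _ => 0) = (fun _ => 0) ->
  forall (P : 'I_m -> mpoly.mpoly n R[i]) (Q : mpoly.mpoly n R[i]),
    rat_rep F P Q -> lowest_terms P Q -> rat_deg P Q = 2%N.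
Proof.
move=> n2 nm mn hD hiso _ F0 P Q hrep low.
have Q_neq0 z : in_ball z -> peval z Q != 0 by move=> /hrep [].
have FE z : in_ball z -> F z = ratmap P Q z.
  by move=> /hrep [_ h]; apply/funext => k; exact: h.
have f0 : ratmap P Q (fun=> 0) = fun=> 0 by rewrite -FE ?F0 //; exact: in_ball0.
have m0 : (0 < m)%N by exact: leq_trans nm.
have [kappa k0 iso] := isometry_identity Q_neq0 m0 FE hD hiso.
have k1 : kappa = 1 by exact: (kappa_eq1 Q_neq0 iso f0 k0).
rewrite k1 in iso.
have [u [form uu ju]] := normal_form Q_neq0 iso f0 mn.
exact: (rat_deg_eq2 Q_neq0 (quadpoly_neq0 Q_neq0 iso f0 mn) form uu ju low).
Qed.
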